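(* (a) MTS-MIV in the same direction implies SDC, i.e. it implies $$\mathrm{Cov}(Y_d,D)\,\mathrm{Cov}(Y_d,Z)\ge 0\quad\text{for each } d\in\mathcal D .$$ (b) When both $D$ and $Z$ are binary, the following three conditions are equivalent: MTS-MIV in the same direction; $Z$ is a binarized MTS-MIV for $D$; SDC. (c) However, in general there is a case where $Z$ is a binarized MTS-MIV for $D$ but joint MTS-MIV fails. An example is: $V$ uniform on $[0,5]$; $D=0$ if $V\in[0,1]$, $D=1$ if $V\in(1,\tfrac32]$, $D=2$ if $V\in(\tfrac32,5]$; $Z=2D$; $U=4V$ if $V\in[1,2]$ and $U=V$ if $V\notin[1,2]$; $Y_d=2d+U$ for $d\in\{0,1,2\}$ (treatment levels here labelled $0,1,2$). (d) If MTS and MIV hold in opposite directions, then SDC will not hold. Instead, the ''opposite directions of correlation'' condition $\mathrm{Cov}(Y_d,D)\,\mathrm{Cov}(Y_d,Z)\le 0$ holds. (e) In general, if the directions of the MTS and MIV assumptions are unknown (i.e. not specified to be the same), SDC is not weaker than MTS-MIV; that is, MTS and MIV holding jointly does not in general imply SDC.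
   Context: Setting: all random variables live on one probability space. $D$ is a discrete random variable (treatment) with values in $\mathcal D=\{1,2,\dots,T\}$; for each $d\in\mathcal D$, $Y_d$ is an integrable real random variable (potential outcome); $Z$ is a real random variable (imperfect instrument) with values in $\mathcal Z\subseteq\mathbb R$. The covariances are assumed to be well defined. Definitions. MTS (monotone treatment selection): $\ell\mapsto\mathrm{E}[Y_d\mid D=\ell]$ is monotone for all $d\in\mathcal D$. MIV (monotone instrumental variable): $z\mapsto\mathrm{E}[Y_d\mid Z=z]$ is monotone for all $d\in\mathcal D$. MTS-MIV: both MTS and MIV hold. MTS-MIV in the same direction: for each $d$, these two functions are both nondecreasing or both nonincreasing. Opposite directions: for each $d$, one of them is nondecreasing and the other nonincreasing. SDC (same direction of correlation): $\mathrm{Cov}(Y_d,D)\,\mathrm{Cov}(Y_d,Z)\ge 0$ for each $d\in\mathcal D$. $Z$ is a binarized MTS-MIV for $D$ if for each $d\in\mathcal D$, $\big(\mathrm{E}[Y_d\mid D\ge j]-\mathrm{E}[Y_d\mid D<j]\big)\big(\mathrm{E}[Y_d\mid Z\ge z]-\mathrm{E}[Y_d\mid Z<z]\big)\ge 0$ for all $j,z$. Conventions: $j,\ell,z$ range over values for which the conditional expectations involved are defined (for events, positive probability), and monotonicity of $z\mapsto\mathrm{E}[Y_d\mid Z=z]$ refers to some version of this function. ''Binary'' means taking two values, each with positive probability.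
   Formalization: In (d), ''SDC will not hold'' is false in degenerate cases (e.g. all Y_d constant); it is replaced by: SDC fails if and only if for some d neither E[Y_d|D=ℓ] nor E[Y_d|Z=z] is constant (up to versions). *)

(* Defs.v *)
From HB Require Import structures.
From mathcomp Require Import all_boot all_order all_algebra.
From mathcomp Require Import all_classical all_reals all_analysis.
Set Implicit Arguments.
Unset Strict Implicit.
Unset Printing Implicit Defensive.
Import Order.TTheory GRing.Theory Num.Theory.

Local Open Scope classical_set_scope.
Local Open Scope ring_scope.

Section instruments.
Context {d : measure_display} {Omega : measurableType d} {R : realType}.
Variable P : probability Omega R.

(* E[X | A]; meaningful only when P A > 0 *)
Definition cmean (A : set Omega) (X : Omega -> R) : R :=
  (\int[P]_(w in A) X w) / fine (P A).

(* h is a version of z |-> E[X | Z = z] *)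
Definition is_cmean_version (X Z : Omega -> R) (h : R -> R) : Prop :=
  [/\ measurable_fun [set: R] h,
      P.-integrable [set: Omega] (EFin \o (h \o Z)) &
      forall B : set R, measurable B ->
        \int[P]_(w in Z @^-1` B) X w = \int[P]_(w in Z @^-1` B) h (Z w)].

Definition mts_nondecr (X : Omega -> R) (D : Omega -> nat) : Prop :=
  forall l l' : nat,
    (0 < P (D @^-1` [set l]))%E -> (0 < P (D @^-1` [set l']))%E ->
    (l <= l')%N ->
    cmean (D @^-1` [set l]) X <= cmean (D @^-1` [set l']) X.

Definition mts_nonincr (X : Omega -> R) (D : Omega -> nat) : Prop :=
  forall l l' : nat,
    (0 < P (D @^-1` [set l]))%E -> (0 < P (D @^-1` [set l']))%E ->
    (l <= l')%N ->
    cmean (D @^-1` [set l']) X <= cmean (D @^-1` [set l]) X.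

Definition mts_const (X : Omega -> R) (D : Omega -> nat) : Prop :=
  forall l l' : nat,
    (0 < P (D @^-1` [set l]))%E -> (0 < P (D @^-1` [set l']))%E ->
    cmean (D @^-1` [set l]) X = cmean (D @^-1` [set l']) X.

(* ZZ is the set of values of the instrument; monotonicity of the conditional
   mean is only required there. *)
Definition miv_nondecr (ZZ : set R) (X Z : Omega -> R) : Prop :=
  exists2 h, is_cmean_version X Z h &
    forall z z', ZZ z -> ZZ z' -> z <= z' -> h z <= h z'.

Definition miv_nonincr (ZZ : set R) (X Z : Omega -> R) : Prop :=
  exists2 h, is_cmean_version X Z h &
    forall z z', ZZ z -> ZZ z' -> z <= z' -> h z' <= h z.

Definition miv_const (X Z : Omega -> R) : Prop :=
  exists c : R, is_cmean_version X Z (fun=> c).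

(* The probability that X is one of the two values is 1; X may take other
   values on a null set. *)
Definition binary (U : Type) (X : Omega -> U) : Prop :=
  exists x y : U,
    [/\ x <> y, (0 < P (X @^-1` [set x]))%E, (0 < P (X @^-1` [set y]))%E
      & P (X @^-1` [set x; y]) = 1%E].

(* DD is the set of treatment levels; the outcomes Y k with k outside DD play
   no role. *)
Variables (DD : set nat) (ZZ : set R) (D : {RV P >-> nat}) (Z : {RV P >-> R})
  (Y : nat -> {RV P >-> R}).

(* D is bounded when DD is finite, so the integrability of D and of Y k * D,
   needed for Cov(Y k, D), is automatic. *)
Record setting : Prop := Setting {
  D_in : forall w, DD (D w);
  Z_in : forall w, ZZ (Z w);
  Y_integrable : forall k, DD k -> P.-integrable [set: Omega] (EFin \o Y k);
  Z_integrable : P.-integrable [set: Omega] (EFin \o Z);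
  YZ_integrable : forall k, DD k ->
    P.-integrable [set: Omega] (EFin \o (fun w => Y k w * Z w)) }.

Definition MTS : Prop :=
  forall k, DD k -> mts_nondecr (Y k) D \/ mts_nonincr (Y k) D.

Definition MIV : Prop :=
  forall k, DD k -> miv_nondecr ZZ (Y k) Z \/ miv_nonincr ZZ (Y k) Z.

Definition MTS_MIV : Prop := MTS /\ MIV.

Definition MTS_MIV_same : Prop :=
  forall k, DD k ->
    (mts_nondecr (Y k) D /\ miv_nondecr ZZ (Y k) Z) \/
    (mts_nonincr (Y k) D /\ miv_nonincr ZZ (Y k) Z).

Definition MTS_MIV_opposite : Prop :=
  forall k, DD k ->
    (mts_nondecr (Y k) D /\ miv_nonincr ZZ (Y k) Z) \/
    (mts_nonincr (Y k) D /\ miv_nondecr ZZ (Y k) Z).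

Definition cov_product (k : nat) : \bar R :=
  (covariance P (Y k) (fun w => (D w)%:R) * covariance P (Y k) Z)%E.

Definition SDC : Prop := forall k, DD k -> (0 <= cov_product k)%E.

Definition ODC : Prop := forall k, DD k -> (cov_product k <= 0)%E.

Definition binarized_MTS_MIV : Prop :=
  forall k, DD k -> forall (j : nat) (z : R),
    let Dge := [set w | (j <= D w)%N] in let Dlt := [set w | (D w < j)%N] in
    let Zge := [set w | z <= Z w] in let Zlt := [set w | Z w < z] in
    (0 < P Dge)%E -> (0 < P Dlt)%E -> (0 < P Zge)%E -> (0 < P Zlt)%E ->
    0 <= (cmean Dge (Y k) - cmean Dlt (Y k)) *
         (cmean Zge (Y k) - cmean Zlt (Y k)).

End instruments.

Definition treatments (T : nat) : set nat := [set k | (1 <= k <= T)%N].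

(* V has values in [0, 5] almost surely, so the last branch of ex_D is the
   interval ]3/2, 5] up to a null set. *)
Definition ex_D (R : realType) (v : R) : nat :=
  if v \in `[0, 1] then 0%N else if v \in `]1, 3 / 2] then 1%N else 2%N.

Definition ex_U (R : realType) (v : R) : R :=
  if v \in `[1, 2] then 4 * v else v.

Definition uniform05 (d : measure_display) (Omega : measurableType d)
    (R : realType) (P : probability Omega R) (V : {RV P >-> R}) : Prop :=
  forall (h05 : (0 : R) < 5) (B : set R), measurable B ->
    distribution P V B = uniform_prob h05 B.

Definition ex_treatments : set nat := [set 0%N; 1%N; 2%N].

Definition ex_instruments (R : realType) : set R := [set 0; 2; 4].
Arguments ex_instruments R : clear implicits.

Record counterexample (d : measure_display) (Omega : measurableType d)
    (R : realType) (P : probability Omega R) (V : {RV P >-> R})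
    (D : {RV P >-> nat}) (Z : {RV P >-> R}) (Y : nat -> {RV P >-> R}) : Prop :=
  Counterexample {
    ex_V_law : uniform05 V;
    ex_D_def : forall w, D w = ex_D (V w);
    ex_Z_def : forall w, Z w = 2 * (D w)%:R;
    ex_Y_def : forall k, ex_treatments k ->
      forall w, Y k w = 2 * k%:R + ex_U (V w) }.

(* Main.v *)
Require Import Defs.
From mathcomp Require Import all_boot all_order all_algebra.
From mathcomp Require Import all_classical all_reals all_analysis.
From mathcomp Require Import finmap measurable_realfun ring lra.
Set Implicit Arguments.
Unset Strict Implicit.
Unset Printing Implicit Defensive.
Import Order.TTheory GRing.Theory Num.Theory.
Local Open Scope classical_set_scope.
Local Open Scope ring_scope.

(** Covariances with a conditioning variable [W] of mean [m] are signed through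
    [Cov(X, W) = E[(X - c)(W - m)]], valid for every constant [c]. When the
    conditional mean of [X] given [W] is nondecreasing, [c] can be chosen so that
    this conditional mean lies below [c] on [W <= m] and above [c] on [m <= W].
    Then [E[X - c; W in B]] has the sign of [W - m] on every [B] on one side of
    [m], hence the covariance is nonnegative, and it vanishes only if all these
    integrals do, i.e. only if the conditional mean is constant. Arguing with
    events instead of with [h(W)(W - m)] avoids the integrability of the latter.
    Parts (a), (d) and (e) follow by multiplying signs. For two-valued [D] and
    [Z] all three conditions say that the jumps of the two conditional means have
    a nonnegative product. In (c) the conditional means of [U] given [D = 0, 1, 2]
    are 1/2, 5, 4, while splitting at [D >= 1] or [D >= 2] gives upward jumps 29/8
    and 2. *)

(** * Integrals over events *)

Section conditional_positivity.
Context {d : measure_display} {Omega : measurableType d} {R : realType}.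
Variable P : probability Omega R.
Implicit Types (G X W : Omega -> R) (f h : R -> R) (B : set R).

Local Notation integrable X := (P.-integrable [set: Omega] (EFin \o X)).

Lemma integrable_measurable X : integrable X -> measurable_fun [set: Omega] X.
Proof. by move=> /measurable_int/measurable_EFinP. Qed.

Lemma measurable_preimage W B : measurable_fun [set: Omega] W ->
  measurable B -> measurable (W @^-1` B).
Proof. by move=> mW mB; rewrite -[_ @^-1` _]setTI; exact: mW. Qed.

Lemma integrable_cst (r : R) : integrable (fun=> r).
Proof. exact: finite_measure_integrable_cst. Qed.

Lemma integrable_subr X (c : R) : integrable X -> integrable (fun w => X w - c).
Proof. by move=> iX; exact: (integrableB measurableT iX (integrable_cst c)). Qed.

Lemma integrable_mull X (c : R) : integrable X -> integrable (fun w => c * X w).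
Proof. by move=> iX; exact: (integrableZl measurableT c iX). Qed.

Lemma integrable_restr X A : measurable A -> integrable X ->
  P.-integrable A (EFin \o X).
Proof. by move=> mA; apply: integrableS. Qed.

Lemma integrable_indicM X A : measurable A -> integrable X ->
  integrable (fun w => X w * \1_A w).
Proof.
move=> mA iX; apply: (le_integrable _ _ _ iX) => //.
  apply/measurable_EFinP; apply: measurable_funM; first exact: integrable_measurable.
  exact: measurable_indic.
move=> w _ /=; rewrite lee_fin normrM indicE.
by case: (w \in A); rewrite ?normr1 ?normr0 ?mulr1 ?mulr0.
Qed.

Lemma Rintegral_indicM X A :
  \int[P]_w (X w * \1_A w) = \int[P]_(w in A) X w.
Proof.
rewrite [RHS]Rintegral_mkcond; apply: eq_Rintegral => w _.
by rewrite patchE indicE; case: (w \in A); rewrite ?mulr1 ?mulr0.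
Qed.

Lemma Rintegral_sum (I : Type) (s : seq I) (F : I -> Omega -> R) :
  (forall i, integrable (F i)) ->
  integrable (fun w => \sum_(i <- s) F i w) /\
  \int[P]_w (\sum_(i <- s) F i w) = \sum_(i <- s) \int[P]_w F i w.
Proof.
move=> iF; elim: s => [|i s [iS eS]].
  split.
    by under eq_fun do rewrite big_nil; exact: integrable_cst.
  rewrite big_nil; under eq_Rintegral do rewrite big_nil.
  by rewrite Rintegral_cst// mul0r.
split.
  under eq_fun do rewrite big_cons.
  exact: (integrableD measurableT (iF i) iS).
by under eq_Rintegral do rewrite big_cons; rewrite RintegralD// eS big_cons.
Qed.

Import HBNNSimple.

(** Approximate [f] from below by simple functions [f_ n]. The integral of [G * f_ n W] is a
    combination of integrals of [G] over events of [W], with the nonnegative values of [f_ n] as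
    coefficients, and dominated convergence passes the sign to the limit. *)
Lemma cond_nonneg_mul G W f :
  integrable G -> measurable_fun [set: Omega] W ->
  measurable_fun [set: R] f -> (forall r, 0 <= f r) ->
  integrable (fun w => G w * f (W w)) ->
  (forall B, measurable B -> B `<=` [set r | 0 < f r] ->
     0 <= \int[P]_(w in W @^-1` B) G w) ->
  0 <= \int[P]_w (G w * f (W w)).
Proof.
move=> iG mW mf f0 iGf posB.
have mfe : measurable_fun [set: R] (EFin \o f) by exact/measurable_EFinP.
pose f_ := nnsfun_approx measurableT mfe.
have cvf x : (f_ n x)%:E @[n --> \oo] --> (f x)%:E.
  by apply: (cvg_nnsfun_approx measurableT mfe) => // y _; rewrite lee_fin.
have f_f n x : f_ n x <= f x.
  have nd : nondecreasing_seq (fun n => (f_ n x)%:E).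
    move=> p q pq; rewrite lee_fin; apply/lefP: x.
    exact: (nd_nnsfun_approx measurableT mfe pq).
  rewrite -lee_fin (cvg_unique _ (cvf x) (ereal_nondecreasing_cvgn nd))//.
  by apply: ereal_sup_ubound; exists n.
have mGf n : measurable_fun [set: Omega] (fun w => G w * f_ n (W w)).
  apply: measurable_funM; first exact: integrable_measurable.
  by apply: measurableT_comp.
have cvGf w : (G w * f_ n (W w))%:E @[n --> \oo] --> (G w * f (W w))%:E.
  by under eq_fun do rewrite EFinM; rewrite EFinM; exact: cvgeZl.
(* Domination uses the integrability of the product [G * f W], since [f W] alone may fail to be
   integrable. *)
have leGf w n : (`|(G w * f_ n (W w))%:E| <= `|G w * f (W w)|%:E)%E.
  by rewrite lee_fin !normrM ler_wpM2l// !ger0_norm.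
have [_ _ cvG] := @dominated_convergence _ _ _ P _ measurableT
  (fun n w => (G w * f_ n (W w))%:E) (fun w => (G w * f (W w))%:E)
  (fun w => `|G w * f (W w)|%:E)
  (fun n => (measurable_EFinP _ _).2 (mGf n)) (measurable_int _ iGf)
  (aeW _ (fun w _ => cvGf w)) (integrable_norm iGf) (aeW _ (fun w n _ => leGf w n)).
apply: fine_ge0.
rewrite -(cvg_lim _ cvG)//; apply: lime_ge; first by apply: cvgP cvG.
apply: nearW => n /=.
pose s : seq R := fset_set (range (f_ n)).
(* The contribution of the level [y] of the simple function [f_ n]. *)
pose F y w := y * (G w * \1_(W @^-1` (f_ n @^-1` [set y])) w).
have mB y : measurable (f_ n @^-1` [set y]) by [].
have iF y : integrable (F y).
  apply: integrable_mull.
  by apply: integrable_indicM => //; exact: measurable_preimage.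
have [iS eS] := Rintegral_sum s iF.
have -> : (fun w => (G w * f_ n (W w))%:E) = EFin \o (fun w => \sum_(y <- s) F y w).
  apply/funext => w /=; rewrite fimfunE fsbig_finite//= mulr_sumr; congr EFin.
  by apply: eq_bigr => y _; rewrite /F mulrCA.
rewrite -(fineK (integrable_fin_num _ iS))// lee_fin -/(Rintegral _ _ _) eS.
rewrite big_seq; apply: sumr_ge0 => y; rewrite in_fset_set//= => /set_mem[x _ <-].
rewrite RintegralZl//; last first.
  by apply: integrable_indicM => //; exact: measurable_preimage.
(* The zero level contributes nothing. A nonzero level is positive, so its level set lies in [0 < f]
   because [f_ n <= f], and [posB] applies. *)
have [->|fx0] := eqVneq (f_ n x) 0; first by rewrite mul0r.
rewrite mulr_ge0// Rintegral_indicM; apply: posB => // r /= fr.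
by rewrite (lt_le_trans _ (f_f n r))// fr lt_neqAle eq_sym fx0/=.
Qed.

End conditional_positivity.

(** * Sign of a covariance from integrals over events *)

Section covariance_sign.
Context {d : measure_display} {Omega : measurableType d} {R : realType}.
Variable P : probability Omega R.
Implicit Types (G X W : Omega -> R) (f h : R -> R) (B : set R).

Local Notation integrable X := (P.-integrable [set: Omega] (EFin \o X)).
Import HBNNSimple.

Lemma Rintegral_setID X A C : measurable A -> measurable C -> integrable X ->
  \int[P]_(w in A) X w =
  \int[P]_(w in A `&` C) X w + \int[P]_(w in A `\` C) X w.
Proof.
move=> mA mC iX; rewrite -Rintegral_setU ?setUIDK//.
- exact: measurableI.
- exact: measurableD.
- exact: integrable_restr.
- by apply/disj_setPS => x [[_ Cx] [_ nCx]].
Qed.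

Lemma integrable_add X X' : integrable X -> integrable X' ->
  integrable (fun w => X w + X' w).
Proof. by move=> iX iX'; exact: (integrableD measurableT iX iX'). Qed.

Lemma integrable_opp X : integrable X -> integrable (fun w => - X w).
Proof. by move=> iX; exact: (integrableN iX). Qed.

Lemma Rintegral_opp X A : measurable A -> integrable X ->
  \int[P]_(w in A) (- X w) = - (\int[P]_(w in A) X w).
Proof.
move=> mA iX; under eq_Rintegral do rewrite -mulN1r.
by rewrite RintegralZl ?mulN1r//; exact: integrable_restr.
Qed.

Lemma indic_preimage W B w : \1_(W @^-1` B) w = \1_B (W w) :> R.
Proof. by rewrite !indicE; congr (nat_of_bool _)%:R; apply/idP/idP; rewrite !inE. Qed.

(* Once [G * f W] integrates to 0 over every event, [cond_nonneg_mul] applied to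
   [- G * f W] and [1_B / f] gives the missing inequality for [B]. *)
Lemma cond_nonneg_mul_eq0 G W f :
  integrable G -> measurable_fun [set: Omega] W ->
  measurable_fun [set: R] f -> (forall r, 0 <= f r) ->
  integrable (fun w => G w * f (W w)) ->
  (forall B, measurable B -> B `<=` [set r | 0 < f r] ->
     0 <= \int[P]_(w in W @^-1` B) G w) ->
  \int[P]_w (G w * f (W w)) = 0 ->
  forall B, measurable B -> B `<=` [set r | 0 < f r] ->
     \int[P]_(w in W @^-1` B) G w = 0.
Proof.
move=> iG mW mf f0 iGf posB Gf0.
have mWB B : measurable B -> measurable (W @^-1` B) by exact: measurable_preimage.
(* Apply [cond_nonneg_mul] to [f * 1_B], which is positive only where [f] is. *)
have GfB_ge0 B : measurable B -> 0 <= \int[P]_(w in W @^-1` B) (G w * f (W w)).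
  move=> mB; rewrite -Rintegral_indicM.
  under eq_Rintegral do rewrite -mulrA indic_preimage.
  apply: (cond_nonneg_mul (f := fun r => f r * \1_B r)) => //.
  - by apply: measurable_funM => //; exact: measurable_indic.
  - by move=> r; rewrite mulr_ge0.
  - under eq_fun do rewrite mulrA -indic_preimage.
    exact: (integrable_indicM (mWB B mB) iGf).
  - move=> C mC CfB; apply: posB => // r /CfB /=; rewrite indicE.
    by case: (r \in B); rewrite ?mulr1// mulr0 ltxx.
have GfB B : measurable B -> \int[P]_(w in W @^-1` B) (G w * f (W w)) = 0.
  move=> mB; apply/eqP; rewrite eq_le GfB_ge0// andbT.
  (* The integrals over [B] and over its complement are both nonnegative and add up to 0. *)
  have : 0 <= \int[P]_(w in W @^-1` (~` B)) (G w * f (W w)).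
    by apply: GfB_ge0; exact: measurableC.
  have := Rintegral_setU (mu := P) (f := fun w => G w * f (W w))
    (mWB _ mB) (mWB _ (measurableC mB)).
  rewrite -preimage_setU setUv preimage_setT => /(_ iGf).
  rewrite Gf0 => /(_ _)/esym/eqP; rewrite addr_eq0 => eqN.
  rewrite (eqP (eqN _)) ?oppr_le0// -preimage_setC.
  by apply/disj_setPCl.
move=> B mB Bf; apply/eqP; rewrite eq_le posB// andbT -oppr_ge0.
(* On [B] the function [f] is positive, so the power [-1] is its inverse there; elsewhere the
   indicator kills the product. *)
have -> : - (\int[P]_(w in W @^-1` B) G w) =
    \int[P]_w (- (G w * f (W w)) * (\1_B (W w) * f (W w) `^ (-1))).
  rewrite -Rintegral_indicM -Rintegral_opp//; last first.
    exact: (integrable_indicM (mWB B mB) iG).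
  apply: eq_Rintegral => w _; rewrite indic_preimage indicE.
  have [/set_mem/Bf/= fW|] := boolP (W w \in B); last first.
    by rewrite mulr0n mul0r !mulr0 oppr0.
  by rewrite mulr1n powR_inv1 ?ltW// mul1r mulr1 mulNr mulfK ?gt_eqF.
apply: (cond_nonneg_mul (G := fun w => - (G w * f (W w)))
  (f := fun r => \1_B r * f r `^ (-1))) => //.
- exact: integrable_opp.
- apply: measurable_funM; first exact: measurable_indic.
  exact: (measurableT_comp (measurable_powR (-1)) mf).
- by move=> r; rewrite mulr_ge0// powR_ge0.
- rewrite (_ : (fun w => _) = (fun w => - (G w * \1_(W @^-1` B) w))).
    exact/integrable_opp/integrable_indicM/iG/mWB.
  apply/funext => w; rewrite indic_preimage indicE.
  have [/set_mem/Bf/= fW|] := boolP (W w \in B); last first.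
    by rewrite mulr0n mul0r !mulr0 oppr0.
  by rewrite mulr1n powR_inv1 ?ltW// mul1r mulr1 mulNr mulfK ?gt_eqF.
- by move=> C mC _; rewrite Rintegral_opp ?GfB ?oppr0//; exact: mWB.
Qed.

(** The conditional mean of [X] given [W] passes through the level [c] at [m]. The formulation by
    events serves a discrete treatment and a real instrument alike. The clause at [m] itself matters
    for the equality case, since a covariance does not see the event [W = m]. *)
Definition crosses X W (c m : R) : Prop :=
  [/\ forall B, measurable B -> B `<=` [set r | m < r] ->
        0 <= \int[P]_(w in W @^-1` B) (X w - c),
      forall B, measurable B -> B `<=` [set r | r < m] ->
        \int[P]_(w in W @^-1` B) (X w - c) <= 0
    & \int[P]_(w in W @^-1` [set m]) (X w - c) = 0].

(** Since [W - m] has mean 0, the centre of [X] may be moved from its mean to any [c]. *)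
Lemma covariance_subr X W (c : R) :
  integrable X -> integrable W -> integrable (fun w => X w * W w) ->
  let m := \int[P]_w W w in
  integrable (fun w => (X w - c) * (W w - m)) /\
  covariance P X W = (\int[P]_w ((X w - c) * (W w - m)))%:E.
Proof.
move=> iX iW iXW m.
have iXW' a : integrable (fun w => (X w - a) * (W w - m)).
  rewrite (_ : (fun w => _) =
      (fun w => X w * W w + - m * X w + - a * W w + a * m)).
    apply: integrable_add; last exact: integrable_cst.
    apply: integrable_add; last exact: integrable_mull.
    by apply: integrable_add => //; exact: integrable_mull.
  by apply/funext => w; lra.
split=> //; rewrite unlock unlock.
have -> : (fine (\int[P]_w (W w)%:E)%E) = m by [].
set a := fine _.
have -> : (\int[P]_w (((X \- cst a) * (W \- cst m)) w)%:E)%E =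
    (\int[P]_w ((X w - a) * (W w - m)))%:E.
  by rewrite /Rintegral fineK//; exact: integrable_fin_num (iXW' a).
congr EFin.
have -> : \int[P]_w ((X w - a) * (W w - m)) =
    \int[P]_w ((X w - c) * (W w - m) + (c - a) * (W w - m)).
  by apply: eq_Rintegral => w _; lra.
have iWm := integrable_subr m iW.
rewrite RintegralD//; last exact: integrable_mull.
rewrite RintegralZl// RintegralB//; last exact: integrable_cst.
by rewrite Rintegral_cst//= probability_setT /= mulr1 subrr mulr0 addr0.
Qed.

(** Split [W - m] into its positive part [fp] and negative part [fn]. The covariance is the sum of
    the integrals of [G * fp W] and [- G * fn W], each nonnegative by [cond_nonneg_mul]. If the sum
    is 0, both vanish and [cond_nonneg_mul_eq0] applies on each side of [m]. *)
Lemma crosses_covariance X W (c : R) :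
  integrable X -> integrable W -> measurable_fun [set: Omega] W ->
  integrable (fun w => X w * W w) ->
  crosses X W c (\int[P]_w W w) ->
  exists2 r, covariance P X W = r%:E &
    0 <= r /\
    (r = 0 -> forall B, measurable B -> \int[P]_(w in W @^-1` B) (X w - c) = 0).
Proof.
move=> iX iW mW iXW [pos neg eq0].
have [iXcW ->] := covariance_subr c iX iW iXW.
set m := \int[P]_w W w in pos neg eq0 iXcW *.
have iG := integrable_subr c iX.
set G := fun w => X w - c in iG *.
have iGN := integrable_opp iG.
pose fp r := Num.max (r - m) 0; pose fn r := Num.max (m - r) 0.
have mfp : measurable_fun [set: R] fp.
  by apply: measurable_maxr => //; apply: measurable_funB.
have mfn : measurable_fun [set: R] fn.
  by apply: measurable_maxr => //; apply: measurable_funB.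
have fp0 r : 0 <= fp r by rewrite le_max lexx orbT.
have fn0 r : 0 <= fn r by rewrite le_max lexx orbT.
have fpE r : (0 < fp r) = (m < r) by rewrite lt_max ltxx orbF subr_gt0.
have fnE r : (0 < fn r) = (r < m) by rewrite lt_max ltxx orbF subr_gt0.
have fp_le r : `|fp r| <= `|r - m|.
  by rewrite (ger0_norm (fp0 r)) ge_max normr_ge0 ler_norm.
have fn_le r : `|fn r| <= `|r - m|.
  by rewrite (ger0_norm (fn0 r)) ge_max normr_ge0 distrC ler_norm.
have fpnE r : r - m = fp r - fn r by rewrite /fp /fn /Num.max; case: ltP => ?; case: ltP => ?; lra.
have mG := integrable_measurable iG.
have iGp : integrable (fun w => G w * fp (W w)).
  apply: (le_integrable _ _ _ iXcW) => //.
    apply/measurable_EFinP; apply: measurable_funM => //.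
    exact: measurableT_comp.
  by move=> w _ /=; rewrite lee_fin !normrM ler_wpM2l ?fp_le.
have iGn : integrable (fun w => - G w * fn (W w)).
  apply: (le_integrable _ _ _ iXcW) => //.
    apply/measurable_EFinP; apply: measurable_funM => //.
      exact: integrable_measurable iGN.
    exact: measurableT_comp.
  by move=> w _ /=; rewrite lee_fin !normrM normrN ler_wpM2l ?fn_le.
have {}neg B : measurable B -> B `<=` [set r | 0 < fn r] ->
    0 <= \int[P]_(w in W @^-1` B) (- G w).
  move=> mB Bn; rewrite Rintegral_opp// ?oppr_ge0; last exact: measurable_preimage.
  by apply: neg => // r /Bn /=; rewrite fnE.
have {}pos B : measurable B -> B `<=` [set r | 0 < fp r] ->
    0 <= \int[P]_(w in W @^-1` B) G w.
  by move=> mB Bn; apply: pos => // r /Bn /=; rewrite fpE.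
have pos_p := cond_nonneg_mul iG mW mfp fp0 iGp pos.
have pos_n := cond_nonneg_mul iGN mW mfn fn0 iGn neg.
have -> : \int[P]_w (G w * (W w - m)) =
    \int[P]_w (G w * fp (W w)) + \int[P]_w (- G w * fn (W w)).
  by rewrite -RintegralD//; apply: eq_Rintegral => w _; rewrite fpnE; lra.
eexists; first reflexivity.
split; first by rewrite addr_ge0.
move=> sum0 B mB.
have p0 : \int[P]_w (G w * fp (W w)) = 0 by lra.
have n0 : \int[P]_w (- G w * fn (W w)) = 0 by lra.
have {}p0 := cond_nonneg_mul_eq0 iG mW mfp fp0 iGp pos p0.
have {}n0 := cond_nonneg_mul_eq0 iGN mW mfn fn0 iGn neg n0.
have preD C C' : W @^-1` C `\` W @^-1` C' = W @^-1` (C `\` C') by [].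
have mgt : measurable [set r | m < r] by rewrite -set_itvoy.
have mlt : measurable [set r | r < m] by rewrite -set_itvNyo.
(* Cut [B] into its parts above, below and at [m]. *)
rewrite (Rintegral_setID (C := W @^-1` [set r | m < r])) //; first last.
- exact: measurable_preimage.
- exact: measurable_preimage.
rewrite -preimage_setI p0 ?add0r; last 2 first.
- exact: measurableI.
- by move=> r [_ /=]; rewrite fpE.
rewrite preD (Rintegral_setID (C := W @^-1` [set r | r < m])) //; first last.
- exact: measurable_preimage.
- by apply: measurable_preimage => //; exact: measurableD.
rewrite -preimage_setI preD.
have -> : \int[P]_(w in W @^-1` ((B `\` [set r | m < r]) `&` [set r | r < m])) G w = 0.
  apply/eqP; rewrite -oppr_eq0 -Rintegral_opp//; last first.
    apply: measurable_preimage => //.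
    by apply: measurableI => //; exact: measurableD.
  apply/eqP/n0; last by move=> r [_ /=]; rewrite fnE.
  by apply: measurableI => //; exact: measurableD.
rewrite add0r.
(* What is left of [B] is the point [m] or nothing; the point is handled by the last clause of
   [crosses]. *)
have [Bm|Bm] := pselect (B m).
  rewrite (_ : _ `\` _ = [set m]) //; apply/seteqP; split=> [r /= [[_ /negP]]|r /= ->].
    by rewrite -leNgt => rm /negP; rewrite -leNgt => mr; apply/eqP; rewrite eq_le rm.
  by rewrite ltxx.
rewrite (_ : _ `\` _ = set0) ?preimage_set0 ?Rintegral_set0//.
apply/seteqP; split=> // r /= [[Br /negP]].
rewrite -leNgt => rm /negP; rewrite -leNgt => mr; apply: Bm.
by rewrite (_ : m = r)//; apply/eqP; rewrite eq_le rm mr.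
Qed.

End covariance_sign.

(** * Monotone conditional means *)

Section monotone_instrument.
Context {d : measure_display} {Omega : measurableType d} {R : realType}.
Variable P : probability Omega R.
Implicit Types (G X W : Omega -> R) (f h : R -> R) (B : set R).

Local Notation integrable X := (P.-integrable [set: Omega] (EFin \o X)).

(** Take for [c] the supremum of [h] over the points of [S] up to [m]. It is finite because any
    point of [S] beyond [m] provides an upper bound. *)
Lemma monotone_threshold (S : set R) h (m : R) :
  (forall r r', S r -> S r' -> r <= r' -> h r <= h r') ->
  (exists2 r, S r & r <= m) -> (exists2 r, S r & m <= r) ->
  exists c, [/\ forall r, S r -> r <= m -> h r <= c
              & forall r, S r -> m <= r -> c <= h r].
Proof.
move=> hS [a Sa am] [b Sb mb].
pose E := h @` (S `&` [set r | r <= m]).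
have ubE r : S r -> m <= r -> ubound E (h r).
  by move=> Sr mr _ [x [Sx /= xm] <-]; apply: hS => //; exact: le_trans mr.
have supE : has_sup E by split; [exists (h a), a|exists (h b); exact: ubE].
exists (sup E); split=> r Sr rm; last by apply: ge_sup; [case: supE|exact: ubE].
by apply: (ub_le_sup supE.2); exists r.
Qed.

(** Otherwise [W - m] is almost surely positive with mean 0. Then [cond_nonneg_mul_eq0], with
    [G = 1] and [f] the positive part of [r - m], makes [m < W] a null event, although its
    complement is null as well. *)
Lemma prob_le_mean_gt0 W : integrable W ->
  (0 < P (W @^-1` [set r | (r <= \int[P]_w W w)%R]))%E.
Proof.
move=> iW; set m := \int[P]_w W w; set A := W @^-1` _.
have mW := integrable_measurable iW.
have mle : measurable [set r | r <= m] by rewrite -set_itvNyc.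
have mA : measurable A by exact: measurable_preimage.
have iWm := integrable_subr m iW.
rewrite lt0e measure_ge0 andbT; apply/eqP => PA0.
pose f r := Num.max (r - m) 0.
have f0 r : 0 <= f r by rewrite le_max lexx orbT.
have mf : measurable_fun [set: R] f.
  by apply: measurable_maxr => //; apply: measurable_funB.
have mfW : measurable_fun [set: Omega] (fun w => 1 * f (W w)).
  apply: measurable_funM; first exact: measurable_cst.
  exact: (measurableT_comp mf mW).
have if1 : integrable (fun w => 1 * f (W w)).
  apply: (le_integrable _ _ _ iWm) => //; first exact/measurable_EFinP.
  move=> w _ /=; rewrite lee_fin mul1r (ger0_norm (f0 _)).
  by rewrite ge_max normr_ge0 ler_norm.
have intA F : integrable F -> \int[P]_(w in A) F w = 0.
  move=> iF; rewrite /Rintegral null_set_integral//.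
  exact: measurable_funTS (measurable_int _ iF).
have pos B : measurable B -> B `<=` [set r | 0 < f r] ->
    0 <= \int[P]_(w in W @^-1` B) (1 : R).
  by move=> _ _; apply: Rintegral_ge0.
have f1 : \int[P]_w (1 * f (W w)) = 0.
  rewrite (Rintegral_setID (C := A))// setTI intA// add0r.
  (* Off the null event [A] the positive part is [W - m] itself, whose integral is 0. *)
  rewrite (_ : Rintegral _ _ _ = \int[P]_(w in [set: Omega] `\` A) (W w - m)).
    have : \int[P]_w (W w - m) = 0.
      rewrite RintegralB//; last exact: integrable_cst.
      by rewrite Rintegral_cst//= probability_setT/= mulr1 subrr.
    by rewrite (Rintegral_setID (C := A))// setTI intA// add0r.
  apply: eq_Rintegral => w /set_mem[_ /negP]; rewrite -ltNge => mw.
  by rewrite mul1r /f; apply/max_idPl; rewrite subr_ge0 ltW.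
have i1 : integrable (fun=> 1) by exact: integrable_cst.
have /(_ [set r | m < r]) := cond_nonneg_mul_eq0 i1 mW mf f0 if1 pos f1.
have mgt : measurable [set r | m < r] by rewrite -set_itvoy.
move=> /(_ mgt); rewrite Rintegral_cst ?mul1r; last exact: measurable_preimage.
have -> : W @^-1` [set r | m < r] = ~` A.
  by apply/seteqP; split=> w /=; rewrite ltNge => /negP.
rewrite /= probability_setC// PA0 sube0 /= => /(_ _)/eqP; rewrite oner_eq0.
move=> H; suff : false by []; apply: H => r /= mr.
by rewrite lt_max subr_gt0 mr.
Qed.

(** The event [W <= m] has positive probability, so it cannot lie inside the negligible event where
    [W] avoids [S]. *)
Lemma le_mean_value W (S : set R) : integrable W ->
  P.-negligible (W @^-1` (~` S)) -> exists2 r, S r & r <= \int[P]_w W w.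
Proof.
move=> iW nS; have := prob_le_mean_gt0 iW; apply: contraPP => noS.
have sub : W @^-1` [set r | r <= \int[P]_w W w] `<=` W @^-1` (~` S).
  by move=> w /= Wm SW; apply: noS; exists (W w).
have := negligibleS sub nS.
rewrite negligibleP ?lt0e => [->|]; first by rewrite eqxx.
apply: measurable_preimage; first exact: integrable_measurable iW.
by rewrite -set_itvNyc.
Qed.

Lemma ge_mean_value W (S : set R) : integrable W ->
  P.-negligible (W @^-1` (~` S)) -> exists2 r, S r & \int[P]_w W w <= r.
Proof.
move=> iW nS.
have [] := @le_mean_value (fun w => - W w) (-%R @^-1` S).
- exact: integrable_opp.
- by apply: negligibleS nS => w /=; rewrite opprK.
- by move=> r Sr; rewrite Rintegral_opp// => rm; exists (- r) => //; rewrite lerNr.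
Qed.

(** Here [S] carries [W], and the last two hypotheses express that [h] acts on [S] as a conditional
    mean of [X] given [W]. The threshold of [h] at the mean is the crossing level; if the mean lies
    in [S], [h] is squeezed to [c] there, which gives the clause at [m]. *)
Lemma crosses_of_monotone X W (S : set R) h : integrable W ->
  P.-negligible (W @^-1` (~` S)) ->
  (forall r r', S r -> S r' -> r <= r' -> h r <= h r') ->
  (forall c B, measurable B -> (forall r, B r -> S r -> c <= h r) ->
     0 <= \int[P]_(w in W @^-1` B) (X w - c)) ->
  (forall c B, measurable B -> (forall r, B r -> S r -> h r <= c) ->
     \int[P]_(w in W @^-1` B) (X w - c) <= 0) ->
  exists c, crosses P X W c (\int[P]_w W w).
Proof.
move=> iW nS hS ge_c le_c; set m := \int[P]_w W w.
have [c [le_h ge_h]] := monotone_threshold hS (le_mean_value iW nS) (ge_mean_value iW nS).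
exists c; split=> [B mB Bm|B mB Bm|].
- by apply: ge_c => // r Br Sr; apply: ge_h => //; exact/ltW/Bm.
- by apply: le_c => // r Br Sr; apply: le_h => //; exact/ltW/Bm.
- apply/eqP; rewrite eq_le ge_c ?le_c//.
  + by move=> r -> Sm; exact: le_h.
  + by move=> r -> Sm; exact: ge_h.
Qed.

Lemma covariance_opp X W : integrable X -> integrable W ->
  integrable (fun w => X w * W w) ->
  covariance P (fun w => - X w) W = (- covariance P X W)%E.
Proof.
move=> iX iW iXW.
have [iXm ->] := covariance_subr 0 iX iW iXW.
have iXW' : integrable (fun w => - X w * W w).
  by under eq_fun do rewrite mulNr; exact: integrable_opp.
have [_ ->] := covariance_subr 0 (integrable_opp iX) iW iXW'.
rewrite -EFinN; congr EFin; rewrite -[RHS]Rintegral_opp//.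
by apply: eq_Rintegral => w _; lra.
Qed.

Lemma is_cmean_version_opp X Z h : integrable X -> measurable_fun [set: Omega] Z ->
  is_cmean_version P X Z h ->
  is_cmean_version P (fun w => - X w) Z (fun r => - h r).
Proof.
move=> iX mZ [mh ih eh]; split.
- exact: measurableT_comp.
- exact: (integrable_opp ih).
- move=> B mB; rewrite !Rintegral_opp ?eh//; exact: measurable_preimage.
Qed.

Lemma miv_nonincr_opp (ZZ : set R) X Z : integrable X -> measurable_fun [set: Omega] Z ->
  miv_nonincr P ZZ X Z -> miv_nondecr P ZZ (fun w => - X w) Z.
Proof.
move=> iX mZ [h vh hZ]; exists (fun r => - h r); first exact: is_cmean_version_opp.
by move=> z z' Zz Zz' zz'; rewrite lerN2; exact: hZ.
Qed.

Lemma miv_const_opp X Z : integrable X -> measurable_fun [set: Omega] Z ->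
  miv_const P (fun w => - X w) Z -> miv_const P X Z.
Proof.
move=> iX mZ [c vc]; exists (- c).
have := is_cmean_version_opp (integrable_opp iX) mZ vc.
by rewrite (_ : (fun w => - - X w) = X)//; apply/funext => w; rewrite opprK.
Qed.

(** The carrier is the range of [Z], which makes the exceptional event empty whatever [ZZ] is. If
    the covariance vanishes, [X - c] integrates to 0 over every event of [Z], so the constant [c] is
    a version. *)
Lemma miv_nondecr_covariance_ge0 (ZZ : set R) X Z :
  (forall w, ZZ (Z w)) -> integrable X -> integrable Z ->
  integrable (fun w => X w * Z w) -> miv_nondecr P ZZ X Z ->
  exists2 r, covariance P X Z = r%:E & 0 <= r /\ (r = 0 -> miv_const P X Z).
Proof.
move=> ZZZ iX iZ iXZ [h [mh ih eh] hZZ].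
have mZ := integrable_measurable iZ.
have mZB B : measurable B -> measurable (Z @^-1` B) by exact: measurable_preimage.
have eh' c B : measurable B -> \int[P]_(w in Z @^-1` B) (X w - c) =
    \int[P]_(w in Z @^-1` B) (h (Z w) - c).
  move=> mB; have := mZB B mB => mW.
  have i2 : P.-integrable (Z @^-1` B) (EFin \o (fun=> c)).
    exact/integrable_restr/integrable_cst.
  rewrite !RintegralB ?eh//; exact: integrable_restr.
have [||||c crc] := @crosses_of_monotone X Z (range Z) h iZ.
- rewrite (_ : _ @^-1` _ = set0); first exact: negligible_set0.
  by apply/seteqP; split=> // w /=; apply; exists w.
- by move=> _ _ [w _ <-] [w' _ <-]; apply: hZZ.
- move=> c B mB hc; rewrite eh'//; apply: Rintegral_ge0 => w Bw.
  by rewrite subr_ge0; apply: hc => //; exists w.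
- move=> c B mB hc; rewrite eh'// -oppr_ge0 -Rintegral_opp; last 2 first.
    exact: mZB.
    exact: integrable_subr.
  by apply: Rintegral_ge0 => w Bw; rewrite opprB subr_ge0; apply: hc => //; exists w.
have [r -> [r0 rc]] := crosses_covariance iX iZ mZ iXZ crc.
exists r => //; split=> // /rc cZ; exists c; split=> //; first exact: integrable_cst.
move=> B mB; apply/eqP; rewrite -subr_eq0 -RintegralB; first by rewrite cZ.
- exact: mZB.
- exact/integrable_restr/iX/mZB.
- by apply: integrable_restr; [exact: mZB|exact: integrable_cst].
Qed.

Lemma miv_const_nondecr (ZZ : set R) X Z : miv_const P X Z -> miv_nondecr P ZZ X Z.
Proof. by move=> [c vc]; exists (fun=> c). Qed.

Lemma miv_const_nonincr (ZZ : set R) X Z : miv_const P X Z -> miv_nonincr P ZZ X Z.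
Proof. by move=> [c vc]; exists (fun=> c). Qed.

Lemma miv_nonincr_covariance_le0 (ZZ : set R) X Z :
  (forall w, ZZ (Z w)) -> integrable X -> integrable Z ->
  integrable (fun w => X w * Z w) -> miv_nonincr P ZZ X Z ->
  exists2 r, covariance P X Z = r%:E & r <= 0 /\ (r = 0 -> miv_const P X Z).
Proof.
move=> ZZZ iX iZ iXZ hX; have mZ := integrable_measurable iZ.
have iXZ' : integrable (fun w => - X w * Z w).
  by under eq_fun do rewrite mulNr; exact: integrable_opp.
have [r] := miv_nondecr_covariance_ge0 ZZZ (integrable_opp iX) iZ iXZ'
  (miv_nonincr_opp iX mZ hX).
rewrite covariance_opp// => /eqP; rewrite eqe_oppLR => /eqP -> [r0 rc].
exists (- r) => //; split; first by rewrite oppr_le0.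
by move=> /eqP; rewrite oppr_eq0 => /eqP/rc/miv_const_opp; exact.
Qed.

(** A constant is both nondecreasing and nonincreasing, so the covariance has both signs. *)
Lemma miv_const_covariance X Z :
  integrable X -> integrable Z -> integrable (fun w => X w * Z w) ->
  miv_const P X Z -> covariance P X Z = 0%E.
Proof.
move=> iX iZ iXZ cX.
have TZ w : [set: R] (Z w) by [].
have [r covr [r0 _]] :=
  miv_nondecr_covariance_ge0 TZ iX iZ iXZ (miv_const_nondecr _ cX).
have [r'] := miv_nonincr_covariance_le0 TZ iX iZ iXZ (miv_const_nonincr _ cX).
rewrite covr => -[<-] [r0' _]; congr EFin.
by apply/eqP; rewrite eq_le r0 r0'.
Qed.

End monotone_instrument.

(** * Monotone treatment selection *)

Section monotone_treatment.
Context {d : measure_display} {Omega : measurableType d} {R : realType}.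
Variable P : probability Omega R.
Implicit Types (G X W : Omega -> R) (f h : R -> R) (B : set R).

Local Notation integrable X := (P.-integrable [set: Omega] (EFin \o X)).

Lemma Rintegral_subr_cmean X A (c : R) : measurable A -> integrable X ->
  \int[P]_(w in A) (X w - c) = fine (P A) * (cmean P A X - c).
Proof.
move=> mA iX.
rewrite RintegralB ?Rintegral_cst//; last 2 first.
- exact: integrable_restr.
- by apply: integrable_restr => //; exact: integrable_cst.
rewrite mulrBr [c * _]mulrC; congr (_ - _).
(* On a null event both sides vanish, whatever the default value of [cmean]. *)
have [PA0|PA0] := eqVneq (P A) 0%E.
  rewrite PA0 /= mul0r /Rintegral null_set_integral//.
  exact: measurable_funTS (measurable_int _ iX).
rewrite /cmean mulrCA mulfV ?mulr1//.
by rewrite fine_eq0// fin_num_measure.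
Qed.

Section treatment.
Variables (D : Omega -> nat) (T : nat).
Hypothesis mD : forall l, measurable (D @^-1` [set l]).
Hypothesis DT : forall w, (D w <= T)%N.

Let W w : R := (D w)%:R.

Lemma Rintegral_treatment_sum X A : measurable A -> integrable X ->
  \int[P]_(w in A) X w =
  \sum_(l <- iota 0 T.+1) \int[P]_(w in A `&` D @^-1` [set l]) X w.
Proof.
move=> mA iX; rewrite -Rintegral_indicM.
have iF l : integrable (fun w => X w * \1_(A `&` D @^-1` [set l]) w).
  by apply: integrable_indicM => //; exact: measurableI.
have [_ eF] := Rintegral_sum (iota 0 T.+1) iF.
transitivity (\sum_(l <- iota 0 T.+1)
    \int[P]_w (X w * \1_(A `&` D @^-1` [set l]) w)); last first.
  by apply: eq_bigr => l _; rewrite Rintegral_indicM.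
rewrite -eF; apply: eq_Rintegral => w _.
(* At each [w] only the term [l = D w] survives; the list has [T.+1] entries because it starts at
   0. *)
have Din : D w \in iota 0 T.+1 by rewrite mem_iota /= add0n ltnS DT.
rewrite (bigD1_seq (D w) Din (iota_uniq _ _)) big1.
  rewrite /= addr0 indicI /=; congr (_ * _).
  by rewrite [X in _ = _ * X]indicE mem_set ?mulr1.
move=> l lD; rewrite indicI /= [X in _ * (_ * X)]indicE memNset ?mulr0//.
by move=> /= /esym/eqP; rewrite (negbTE lD).
Qed.

Lemma measurable_treatment (B : set nat) : measurable (D @^-1` B).
Proof.
rewrite (_ : _ @^-1` _ = \bigcup_(l in B) D @^-1` [set l]).
  by apply: bigcup_measurable => l _.
by apply/seteqP; split=> w /= => [Bw|[l Bl ->]//]; exists (D w).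
Qed.

Lemma measurable_treatment_natr : measurable_fun [set: Omega] W.
Proof. by move=> _ Y _; rewrite setTI; exact: (measurable_treatment (fun n => Y n%:R)). Qed.

Lemma integrable_treatment : integrable W.
Proof.
apply: (le_integrable _ _ _ (integrable_cst P T%:R)) => //.
  exact/measurable_EFinP/measurable_treatment_natr.
by move=> w _; rewrite /= lee_fin !ger0_norm// ler_nat.
Qed.

Lemma integrable_mul_treatment X : integrable X -> integrable (fun w => X w * W w).
Proof.
move=> iX; apply: (le_integrable _ _ _ (integrable_mull T%:R iX)) => //.
  apply/measurable_EFinP/measurable_funM; last exact: measurable_treatment_natr.
  exact: integrable_measurable iX.
move=> w _; rewrite /= lee_fin !normrM mulrC ler_wpM2r//.
by rewrite !ger0_norm// ler_nat.
Qed.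

(** There are countably many levels, so the union [N] of those of probability 0 is negligible. *)
Lemma negligible_treatment : P.-negligible
  (W @^-1` (~` [set r | exists2 l, r = l%:R & (0 < P (D @^-1` [set l]))%E])).
Proof.
pose N l := if P (D @^-1` [set l]) == 0%E then D @^-1` [set l] else set0.
have nN : P.-negligible (\bigcup_l N l).
  apply: negligible_bigcup => l; rewrite /N; case: ifPn => [/eqP P0|_].
    by apply/(negligibleP _ (mD l)).
  exact: negligible_set0.
apply: negligibleS nN => w /= nS; exists (D w) => //; rewrite /N; case: ifPn => //= P0.
by exfalso; apply: nS; exists (D w) => //; rewrite lt0e P0 measure_ge0.
Qed.

(** The carrier is the set of levels of positive probability, seen as reals, where [cmean] is
    monotone. An integral of [X - c] over an event of [W] is a sum over levels of [P (D = l)] times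
    [cmean - c], so its sign can be read term by term. *)
Lemma mts_nondecr_covariance_ge0 X : integrable X -> mts_nondecr P X D ->
  exists2 r, covariance P X W = r%:E & 0 <= r /\ (r = 0 -> mts_const P X D).
Proof.
move=> iX hX; have mW := measurable_treatment_natr.
have splitW c B : measurable B -> \int[P]_(w in W @^-1` B) (X w - c) =
  \sum_(l <- iota 0 T.+1) if l%:R \in B then
    fine (P (D @^-1` [set l])) * (cmean P (D @^-1` [set l]) X - c) else 0.
  move=> mB; rewrite Rintegral_treatment_sum; last 2 first.
    exact: measurable_preimage.
    exact: integrable_subr.
  apply: eq_bigr => l _; case: ifPn => [/set_mem Bl|/negP Bl].
    rewrite -Rintegral_subr_cmean//; congr (Rintegral _ _ _). 
    by apply/seteqP; split=> w /= => [[]//|Dl]; split=> //; rewrite /W Dl.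
  rewrite (_ : _ `&` _ = set0) ?Rintegral_set0//.
  apply/seteqP; split=> w //= [Bw Dl]; apply: Bl; apply/mem_set.
  by rewrite -Dl; exact: Bw.
have [|||c crc] := @crosses_of_monotone _ _ _ P X W
  [set r | exists2 l, r = l%:R & (0 < P (D @^-1` [set l]))%E]
  (* Truncation recovers a level from its image in [R]. *)
  (fun r => cmean P (D @^-1` [set Num.truncn r]) X) integrable_treatment
  negligible_treatment.
- move=> _ _ [l -> Pl] [l' -> Pl']; rewrite ler_nat !natrK; exact: hX.
- move=> c B mB hc; rewrite splitW//; apply: sumr_ge0 => l _.
  case: ifPn => // /set_mem Bl.
  have [->|P0] := eqVneq (P (D @^-1` [set l])) 0%E; first by rewrite mul0r.
  rewrite mulr_ge0 ?fine_ge0// subr_ge0.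
  have := hc _ Bl; rewrite natrK; apply; exists l => //.
  by rewrite lt0e P0 measure_ge0.
- move=> c B mB hc; rewrite splitW//; apply: sumr_le0 => l _.
  case: ifPn => // /set_mem Bl.
  have [->|P0] := eqVneq (P (D @^-1` [set l])) 0%E; first by rewrite mul0r.
  rewrite mulr_ge0_le0 ?fine_ge0// subr_le0.
  have := hc _ Bl; rewrite natrK; apply; exists l => //.
  by rewrite lt0e P0 measure_ge0.
have [r -> [r0 rc]] := crosses_covariance iX integrable_treatment mW
  (integrable_mul_treatment iX) crc.
exists r => //; split=> // /rc cW.
(* In the case of equality, test the vanishing integrals on single levels. *)
have cE l : (0 < P (D @^-1` [set l]))%E -> cmean P (D @^-1` [set l]) X = c.
  move=> Pl; have := cW [set l%:R] (measurable_set1 _).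
  rewrite (_ : W @^-1` _ = D @^-1` [set l]); last first.
    by apply/seteqP; split=> w /= => [/eqP|Dl]; [rewrite eqr_nat => /eqP|rewrite /W Dl].
  rewrite Rintegral_subr_cmean// => /eqP; rewrite mulf_eq0 subr_eq0.
  by rewrite fine_eq0 ?fin_num_measure// gt_eqF//= => /eqP.
by move=> l l' /cE-> /cE->.
Qed.

Lemma cmean_opp X A : measurable A -> integrable X ->
  cmean P A (fun w => - X w) = - cmean P A X.
Proof. by move=> mA iX; rewrite /cmean Rintegral_opp// mulNr. Qed.

Lemma mts_nonincr_covariance_le0 X : integrable X -> mts_nonincr P X D ->
  exists2 r, covariance P X W = r%:E & r <= 0 /\ (r = 0 -> mts_const P X D).
Proof.
move=> iX hX; have iXW := integrable_mul_treatment iX.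
have [||r] := @mts_nondecr_covariance_ge0 (fun w => - X w).
- exact: integrable_opp.
- by move=> l l' Pl Pl' ll'; rewrite !cmean_opp// lerN2; exact: hX.
rewrite covariance_opp//; last exact: integrable_treatment.
move=> /eqP; rewrite eqe_oppLR => /eqP -> [r0 rc].
exists (- r) => //; split; first by rewrite oppr_le0.
move=> /eqP; rewrite oppr_eq0 => /eqP/rc cX l l' Pl Pl'.
by apply: oppr_inj; rewrite -!cmean_opp//; exact: cX.
Qed.

Lemma mts_const_nondecr X : mts_const P X D -> mts_nondecr P X D.
Proof. by move=> cX l l' Pl Pl' _; rewrite (cX l l'). Qed.

Lemma mts_const_nonincr X : mts_const P X D -> mts_nonincr P X D.
Proof. by move=> cX l l' Pl Pl' _; rewrite (cX l l'). Qed.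

Lemma mts_const_covariance X : integrable X -> mts_const P X D ->
  covariance P X W = 0%E.
Proof.
move=> iX cX.
have [r covr [r0 _]] := mts_nondecr_covariance_ge0 iX (mts_const_nondecr cX).
have [r'] := mts_nonincr_covariance_le0 iX (mts_const_nonincr cX).
rewrite covr => -[<-] [r0' _]; congr EFin.
by apply/eqP; rewrite eq_le r0 r0'.
Qed.

End treatment.

End monotone_treatment.

(** * Two-valued variables *)

Section two_valued_conditioning.
Context {d : measure_display} {Omega : measurableType d} {R : realType}.
Variable P : probability Omega R.
Implicit Types (G X W : Omega -> R) (f h : R -> R) (B : set R).

Local Notation integrable X := (P.-integrable [set: Omega] (EFin \o X)).

Lemma Rintegral_setI_full X (A E : set Omega) : measurable A -> measurable E ->
  P (~` E) = 0%E -> integrable X ->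
  \int[P]_(w in A) X w = \int[P]_(w in A `&` E) X w.
Proof.
move=> mA mE PE iX; rewrite (Rintegral_setID mA mE iX).
rewrite [X in _ + X](_ : _ = 0) ?addr0// /Rintegral null_set_integral//.
- exact: measurableD.
- exact: measurable_funTS (measurable_int _ iX).
- by apply: (subset_measure0 _ (measurableC mE)) => //; exact: measurableD.
Qed.

Lemma prob_setI_full (A E : set Omega) : measurable A -> measurable E ->
  P (~` E) = 0%E -> fine (P A) = fine (P (A `&` E)).
Proof.
move=> mA mE PE; have := Rintegral_setI_full mA mE PE (integrable_cst P 1).
by rewrite !Rintegral_cst ?mul1r//; exact: measurableI.
Qed.

Lemma cmean_eq_ae X (A A' E : set Omega) : measurable A -> measurable A' -> measurable E ->
  P (~` E) = 0%E -> A `&` E = A' `&` E -> integrable X ->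
  cmean P A X = cmean P A' X.
Proof.
move=> mA mA' mE PE AA'E iX.
rewrite /cmean (Rintegral_setI_full mA mE)// (Rintegral_setI_full mA' mE)//.
by rewrite (prob_setI_full mA mE)// (prob_setI_full mA' mE)// AA'E.
Qed.

Lemma cmean_Rintegral X A : measurable A -> integrable X ->
  \int[P]_(w in A) X w = cmean P A X * fine (P A).
Proof.
move=> mA iX; have := Rintegral_subr_cmean 0 mA iX.
by rewrite subr0 [RHS]mulrC => <-; apply: eq_Rintegral => w _; rewrite subr0.
Qed.

Section two_valued.
Variables (W : Omega -> R) (x y : R).
Hypotheses (mW : measurable_fun [set: Omega] W) (xy : x < y).
Hypotheses (Px : (0 < P (W @^-1` [set x]))%E) (Py : (0 < P (W @^-1` [set y]))%E).
Hypothesis Pxy : P (W @^-1` [set x; y]) = 1%E.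

Let E := W @^-1` [set x; y].

Let mx : measurable (W @^-1` [set x]).
Proof. exact: measurable_preimage. Qed.

Let my : measurable (W @^-1` [set y]).
Proof. exact: measurable_preimage. Qed.

Let mE : measurable E.
Proof. by apply: measurable_preimage => //; exact: measurableU. Qed.

Let PE : P (~` E) = 0%E.
Proof. by rewrite probability_setC// Pxy subee. Qed.

(** Positive probability on both sides forces [x < z <= y], and then the two events are [W = y] and
    [W = x] up to a null set. *)
Lemma cmean_two_valued_split X (z : R) : integrable X ->
  (0 < P [set w | (z <= W w)%R])%E -> (0 < P [set w | (W w < z)%R])%E ->
  cmean P [set w | z <= W w] X = cmean P (W @^-1` [set y]) X /\
  cmean P [set w | W w < z] X = cmean P (W @^-1` [set x]) X.
Proof.
move=> iX Pge Plt.
have mge : measurable [set w | z <= W w].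
  by rewrite (_ : mkset _ = W @^-1` `[z, +oo[); [exact: measurable_preimage|rewrite set_itvcy].
have mlt : measurable [set w | W w < z].
  by rewrite (_ : mkset _ = W @^-1` `]-oo, z[); [exact: measurable_preimage|rewrite set_itvNyo].
have not0 A : measurable A -> (0 < P A)%E -> A `&` E = set0 -> False.
  move=> mA PA AE; have := subset_measure0 mA (measurableC mE) _ PE.
  move=> PA0; move: PA; rewrite PA0 ?ltxx// => w Aw Ew.
  by have : set0 w by rewrite -AE.
have zy : z <= y.
  rewrite leNgt; apply/negP => yz; apply: (not0 _ mge Pge).
  apply/seteqP; split=> // w /= [zW [] Ww]; move: zW; rewrite Ww leNgt ?yz//.
  by rewrite (lt_trans xy yz).
have xz : x < z.
  rewrite ltNge; apply/negP => zx; apply: (not0 _ mlt Plt).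
  apply/seteqP; split=> // w /= [zW [] Ww]; move: zW; rewrite Ww ltNge ?zx//.
  by rewrite zy.
split; apply: cmean_eq_ae PE _ iX => //; apply/seteqP; split=> w /=.
- by move=> [zW [] Ww]; rewrite /E /= Ww; [move: zW; rewrite Ww leNgt xz|split=> //; right].
- by move=> [Ww Ew]; split=> //; rewrite Ww.
- by move=> [zW [] Ww]; rewrite /E /= Ww; [split=> //; left|move: zW; rewrite Ww ltNge zy].
- by move=> [Ww Ew]; split=> //; rewrite Ww.
Qed.

Lemma two_valued_value (v : R) : (0 < P (W @^-1` [set v]))%E -> v = x \/ v = y.
Proof.
move=> Pv; apply: contrapT => nv.
have mv : measurable (W @^-1` [set v]) by exact: measurable_preimage.
move: Pv; rewrite (subset_measure0 mv (measurableC mE) _ PE) ?ltxx//.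
by move=> w /= Wv [] Ww; apply: nv; rewrite -Wv; [left|right].
Qed.

Lemma Rintegral_two_valued F A : measurable A -> integrable F ->
  \int[P]_(w in A) F w =
  \int[P]_(w in A `&` W @^-1` [set x]) F w + \int[P]_(w in A `&` W @^-1` [set y]) F w.
Proof.
move=> mA iF; rewrite (Rintegral_setID mA mx iF); congr (_ + _).
have mAx : measurable (A `\` W @^-1` [set x]) by exact: measurableD.
rewrite (Rintegral_setID mAx my iF) [X in _ + X](_ : _ = 0) ?addr0.
  congr (Rintegral _ _ _); apply/seteqP; split=> w /= [].
    by move=> [Aw _] Ww.
  by move=> Aw Ww; split=> //; split=> // Wx; move: xy; rewrite -Wx Ww ltxx.
rewrite /Rintegral null_set_integral//.
- exact: measurableD.
- exact: measurable_funTS (measurable_int _ iF).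
- apply: (subset_measure0 _ (measurableC mE)) => //; first exact: measurableD.
  by move=> w /= [[Aw Wx] Wy] [].
Qed.

(** A step function jumping at [y]: once its two values are ordered, it is monotone on the whole
    line, hence on any [ZZ]. *)
Lemma two_valued_version X : integrable X ->
  is_cmean_version P X W (fun z => if z < y then cmean P (W @^-1` [set x]) X
                                   else cmean P (W @^-1` [set y]) X).
Proof.
move=> iX; set cx := cmean P _ X; set cy := cmean P _ X; set h := fun z => _.
have mh : measurable_fun [set: R] h.
  by apply: measurable_fun_ifT => //; exact: measurable_fun_ltr.
have ih : integrable (fun w => h (W w)).
  apply: (le_integrable _ _ _ (integrable_cst P (`|cx| + `|cy|))) => //.
    by apply/measurable_EFinP; exact: (measurableT_comp mh mW).
  move=> w _ /=; rewrite lee_fin [leRHS]ger0_norm ?addr_ge0// /h.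
  by case: ifP => _; rewrite ?lerDl ?lerDr.
split=> // B mB; have mWB : measurable (W @^-1` B) by exact: measurable_preimage.
rewrite (Rintegral_two_valued mWB iX) (Rintegral_two_valued mWB ih).
(* On an atom, either [B] contains [v] and both integrals are [c] times its probability, or the
   event is empty. *)
have atom v c : cmean P (W @^-1` [set v]) X = c -> h v = c ->
    \int[P]_(w in W @^-1` B `&` W @^-1` [set v]) X w =
    \int[P]_(w in W @^-1` B `&` W @^-1` [set v]) h (W w).
  move=> cv hv; have [Bv|Bv] := pselect (B v).
    rewrite (_ : _ `&` _ = W @^-1` [set v]); last first.
      by apply/seteqP; split=> w /= => [[]//|Wv]; rewrite Wv.
    rewrite cmean_Rintegral//; last exact: measurable_preimage.
    rewrite cv -Rintegral_cst//; last exact: measurable_preimage.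
    by apply: eq_Rintegral => w /set_mem /= ->.
  rewrite (_ : _ `&` _ = set0) ?Rintegral_set0//.
  by apply/seteqP; split=> w //= [Bw Wv]; apply: Bv; rewrite -Wv.
congr (_ + _).
  by apply: (atom _ cx); rewrite /h ?xy.
by apply: (atom _ cy); rewrite /h ?ltxx.
Qed.

(** On [W = v] the function [h W] is the constant [h v], so all versions agree at atoms. *)
Lemma is_cmean_version_atom X h (v : R) : is_cmean_version P X W h ->
  (0 < P (W @^-1` [set v]))%E -> h v = cmean P (W @^-1` [set v]) X.
Proof.
move=> [mh ih eh] Pv; rewrite /cmean eh//.
have mv : measurable (W @^-1` [set v]) by exact: measurable_preimage.
rewrite (_ : Rintegral _ _ _ = \int[P]_(w in W @^-1` [set v]) h v).
  rewrite Rintegral_cst// mulfK// fine_eq0 ?fin_num_measure// gt_eqF//.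
by apply: eq_Rintegral => w /set_mem /= ->.
Qed.

Lemma two_valued_miv_nondecr (ZZ : set R) X : integrable X -> (forall w, ZZ (W w)) ->
  miv_nondecr P ZZ X W <->
  cmean P (W @^-1` [set x]) X <= cmean P (W @^-1` [set y]) X.
Proof.
move=> iX WZ; split=> [[h vh hZ]|cxy].
  rewrite -!(is_cmean_version_atom vh)//; apply: hZ (ltW xy).
    (* An atom of positive probability is nonempty, which puts its value in [ZZ]. *)
    have [w Ww] : W @^-1` [set x] !=set0; last by rewrite -Ww.
    by apply/set0P; apply: contraTneq Px => ->; rewrite measure0 ltxx.
  have [w Ww] : W @^-1` [set y] !=set0; last by rewrite -Ww.
  by apply/set0P; apply: contraTneq Py => ->; rewrite measure0 ltxx.
eexists; first exact: two_valued_version.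
move=> z z' _ _ zz' /=; case: ifPn => zy; case: ifPn => // z'y.
by move: zy; rewrite (le_lt_trans zz' z'y).
Qed.

Lemma two_valued_miv_nonincr (ZZ : set R) X : integrable X -> (forall w, ZZ (W w)) ->
  miv_nonincr P ZZ X W <->
  cmean P (W @^-1` [set y]) X <= cmean P (W @^-1` [set x]) X.
Proof.
move=> iX WZ; split=> [[h vh hZ]|cxy].
  rewrite -!(is_cmean_version_atom vh)//; apply: hZ (ltW xy).
    have [w Ww] : W @^-1` [set x] !=set0; last by rewrite -Ww.
    by apply/set0P; apply: contraTneq Px => ->; rewrite measure0 ltxx.
  have [w Ww] : W @^-1` [set y] !=set0; last by rewrite -Ww.
  by apply/set0P; apply: contraTneq Py => ->; rewrite measure0 ltxx.
eexists; first exact: two_valued_version.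
move=> z z' _ _ zz' /=; case: ifPn => zy; case: ifPn => // z'y.
by move: z'y; rewrite (le_lt_trans zz' zy).
Qed.

Lemma two_valued_split_gt0 :
  (0 < P [set w | (y <= W w)%R])%E /\ (0 < P [set w | (W w < y)%R])%E.
Proof.
have mge : measurable [set w | y <= W w].
  by rewrite (_ : mkset _ = W @^-1` `[y, +oo[); [exact: measurable_preimage|rewrite set_itvcy].
have mlt : measurable [set w | W w < y].
  by rewrite (_ : mkset _ = W @^-1` `]-oo, y[); [exact: measurable_preimage|rewrite set_itvNyo].
by split; [apply: lt_le_trans Py _|apply: lt_le_trans Px _];
  apply: le_measure => [||w /= ->//]; exact: mem_set.
Qed.

End two_valued.

Lemma binary_lt (disp : Order.disp_t) (U : orderType disp) (X : Omega -> U) :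
  binary P X -> exists x y : U, [/\ (x < y)%O, (0 < P (X @^-1` [set x]))%E,
    (0 < P (X @^-1` [set y]))%E & P (X @^-1` [set x; y]) = 1%E].
Proof.
move=> [x [y [/eqP xy Px Py Pxy]]]; move: xy; rewrite neq_lt => /orP[xy|yx].
  by exists x, y.
by exists y, x; split=> //; rewrite setUC.
Qed.

End two_valued_conditioning.

(** * Directions and correlations *)

(** To be used with [a] a jump of the conditional mean and [r] the covariance: the weak inequalities
    become an equality of signs because [r] vanishes only with [a]. *)
Lemma sgr_eq_of_direction (R : realDomainType) (a r : R) :
  (0 <= a -> 0 <= r) -> (a <= 0 -> r <= 0) -> (r = 0 -> a = 0) ->
  Num.sg r = Num.sg a.
Proof.
move=> pos neg zero; have [a0|a0|a0] := ltgtP a 0.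
- rewrite (ltr0_sg a0) ltr0_sg// lt_neqAle neg ?ltW// andbT.
  by apply: contraTneq a0 => /zero ->; rewrite ltxx.
- rewrite (gtr0_sg a0) gtr0_sg// lt0r pos ?ltW// andbT.
  by apply: contraTneq a0 => /zero ->; rewrite ltxx.
- rewrite a0 sgr0 (_ : r = 0) ?sgr0//.
  by apply/eqP; rewrite eq_le pos ?neg ?a0.
Qed.

Lemma mul_ge0_same_direction (R : realDomainType) (a b : R) :
  (0 <= a /\ 0 <= b) \/ (a <= 0 /\ b <= 0) <-> 0 <= a * b.
Proof.
split=> [[[a0 b0]|[a0 b0]]|]; [exact: mulr_ge0|exact: mulr_le0|].
have [a0|a0|->] := ltgtP a 0.
- by rewrite nmulr_rge0// => b0; right; split=> //; exact: ltW.
- by rewrite pmulr_rge0// => b0; left; split=> //; exact: ltW.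
- by move=> _; have [b0|/ltW b0] := leP 0 b; [left|right].
Qed.

Section treatment_setting.
Context {d : measure_display} {Omega : measurableType d} {R : realType}.
Variables (P : probability Omega R) (T : nat) (ZZ : set R)
  (D : {RV P >-> nat}) (Z : {RV P >-> R}) (Y : nat -> {RV P >-> R}).
Hypothesis hS : setting (treatments T) ZZ D Z Y.

Let mD l : measurable (D @^-1` [set l]).
Proof. by rewrite -[_ @^-1` _]setTI; apply: measurable_funPT. Qed.

Let DT w : (D w <= T)%N.
Proof. by have /andP[] := D_in hS w. Qed.

Let W w : R := (D w)%:R.

Let mW : measurable_fun [set: Omega] W := measurable_treatment_natr mD.

Let mZ : measurable_fun [set: Omega] Z.
Proof. exact: measurable_funPT. Qed.

Let iY k : treatments T k -> P.-integrable [set: Omega] (EFin \o Y k).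
Proof. by move=> Tk; exact: (Y_integrable hS Tk). Qed.

Let iYZ k : treatments T k ->
  P.-integrable [set: Omega] (EFin \o (fun w => Y k w * Z w)).
Proof. by move=> Tk; exact: (YZ_integrable hS Tk). Qed.

Lemma setting_mts_nondecr k : treatments T k -> mts_nondecr P (Y k) D ->
  exists2 r, covariance P (Y k) W = r%:E & 0 <= r /\ (r = 0 <-> mts_const P (Y k) D).
Proof.
move=> Tk /(mts_nondecr_covariance_ge0 mD DT (iY Tk))[r covr [r0 rc]].
exists r => //; split=> //; split=> // /(mts_const_covariance mD DT (iY Tk)).
by rewrite covr => -[].
Qed.

Lemma setting_mts_nonincr k : treatments T k -> mts_nonincr P (Y k) D ->
  exists2 r, covariance P (Y k) W = r%:E & r <= 0 /\ (r = 0 <-> mts_const P (Y k) D).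
Proof.
move=> Tk /(mts_nonincr_covariance_le0 mD DT (iY Tk))[r covr [r0 rc]].
exists r => //; split=> //; split=> // /(mts_const_covariance mD DT (iY Tk)).
by rewrite covr => -[].
Qed.

Lemma setting_miv_nondecr k : treatments T k -> miv_nondecr P ZZ (Y k) Z ->
  exists2 r, covariance P (Y k) Z = r%:E & 0 <= r /\ (r = 0 <-> miv_const P (Y k) Z).
Proof.
move=> Tk /(miv_nondecr_covariance_ge0 (Z_in hS) (iY Tk) (Z_integrable hS) (iYZ Tk)).
move=> [r covr [r0 rc]]; exists r => //; split=> //; split=> //.
move=> /(miv_const_covariance (iY Tk) (Z_integrable hS) (iYZ Tk)).
by rewrite covr => -[].
Qed.

Lemma setting_miv_nonincr k : treatments T k -> miv_nonincr P ZZ (Y k) Z ->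
  exists2 r, covariance P (Y k) Z = r%:E & r <= 0 /\ (r = 0 <-> miv_const P (Y k) Z).
Proof.
move=> Tk /(miv_nonincr_covariance_le0 (Z_in hS) (iY Tk) (Z_integrable hS) (iYZ Tk)).
move=> [r covr [r0 rc]]; exists r => //; split=> //; split=> //.
move=> /(miv_const_covariance (iY Tk) (Z_integrable hS) (iYZ Tk)).
by rewrite covr => -[].
Qed.

Lemma same_direction_SDC :
  MTS_MIV_same (treatments T) ZZ D Z Y -> SDC (treatments T) D Z Y.
Proof.
move=> same k Tk; rewrite /cov_product; case: (same k Tk) => -[].
  move=> /(setting_mts_nondecr Tk)[r -> [r0 _]] /(setting_miv_nondecr Tk)[s -> [s0 _]].
  by rewrite -EFinM lee_fin mulr_ge0.
move=> /(setting_mts_nonincr Tk)[r -> [r0 _]] /(setting_miv_nonincr Tk)[s -> [s0 _]].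
by rewrite -EFinM lee_fin mulr_le0.
Qed.

(** Keeping the two factors apart, with the exact condition for each to vanish, serves both the sign
    of the product and its strictness. *)
Lemma opposite_directions_cov_product k : treatments T k ->
  (mts_nondecr P (Y k) D /\ miv_nonincr P ZZ (Y k) Z) \/
  (mts_nonincr P (Y k) D /\ miv_nondecr P ZZ (Y k) Z) ->
  exists r s : R, [/\ cov_product D Z Y k = (r * s)%:E, r * s <= 0,
    r = 0 <-> mts_const P (Y k) D & s = 0 <-> miv_const P (Y k) Z].
Proof.
move=> Tk; rewrite /cov_product => -[] [].
  move=> /(setting_mts_nondecr Tk)[r -> [r0 ?]] /(setting_miv_nonincr Tk)[s -> [s0 ?]].
  by exists r, s; split=> //; rewrite mulr_ge0_le0.
move=> /(setting_mts_nonincr Tk)[r -> [r0 ?]] /(setting_miv_nondecr Tk)[s -> [s0 ?]].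
by exists r, s; split=> //; rewrite mulr_le0_ge0.
Qed.

Lemma opposite_directions_ODC :
  MTS_MIV_opposite (treatments T) ZZ D Z Y -> ODC (treatments T) D Z Y.
Proof.
move=> opp k Tk.
by have [r [s [-> rs0 _ _]]] := opposite_directions_cov_product Tk (opp k Tk).
Qed.

(** The product is at most 0, so it is nonnegative only when it is 0, i.e. when one of the two
    factors vanishes. *)
Lemma opposite_directions_not_SDC : MTS_MIV_opposite (treatments T) ZZ D Z Y ->
  ~ SDC (treatments T) D Z Y <->
  exists k, [/\ treatments T k, ~ mts_const P (Y k) D & ~ miv_const P (Y k) Z].
Proof.
move=> opp; split.
  move=> nSDC; apply: contrapT => nk; apply: nSDC => k Tk.
  have [r [s [-> _ rc sc]]] := opposite_directions_cov_product Tk (opp k Tk).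
  rewrite lee_fin; have [/rc->|nr] := pselect (mts_const P (Y k) D).
    by rewrite mul0r.
  have [/sc->|ns] := pselect (miv_const P (Y k) Z); first by rewrite mulr0.
  by exfalso; apply: nk; exists k.
move=> [k [Tk nr ns]] /(_ k Tk).
have [r [s [-> rs0 rc sc]]] := opposite_directions_cov_product Tk (opp k Tk).
rewrite lee_fin => rs0'; have /eqP : r * s = 0 by apply/eqP; rewrite eq_le rs0.
by rewrite mulf_eq0 => /orP[/eqP/rc|/eqP/sc].
Qed.

Hypotheses (binD : binary P D) (binZ : binary P Z).

(* [a] and [b] are the jumps of the conditional mean of [Y k] between the two
   values of [D] and of [Z]; each covariance has the sign of its jump. *)
Lemma binary_jumps k : treatments T k -> exists a b : R,
  [/\ ((mts_nondecr P (Y k) D /\ miv_nondecr P ZZ (Y k) Z) \/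
       (mts_nonincr P (Y k) D /\ miv_nonincr P ZZ (Y k) Z) <-> 0 <= a * b),
      ((forall (j : nat) (z : R),
         (0 < P [set w | (j <= D w)%N])%E -> (0 < P [set w | (D w < j)%N])%E ->
         (0 < P [set w | (z <= Z w)%R])%E -> (0 < P [set w | (Z w < z)%R])%E ->
         0 <= (cmean P [set w | (j <= D w)%N] (Y k) - cmean P [set w | (D w < j)%N] (Y k)) *
           (cmean P [set w | z <= Z w] (Y k) - cmean P [set w | Z w < z] (Y k)))
       <-> 0 <= a * b) &
      ((0 <= cov_product D Z Y k)%E <-> 0 <= a * b)].
Proof.
move=> Tk; have iX := iY Tk.
have [x [y [xy Px Py Pxy]]] := binary_lt binZ.
have [m [n [mn Pm Pn Pmn]]] := binary_lt binD.
have {}mn : (m < n)%N by [].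
have WE l : D @^-1` [set l] = W @^-1` [set l%:R].
  by apply/seteqP; split=> w /= => [Dl|/eqP]; [rewrite /W Dl|rewrite eqr_nat => /eqP].
have mnW : m%:R < n%:R :> R by rewrite ltr_nat.
have PmnW : P (W @^-1` [set m%:R; n%:R]) = 1%E by rewrite preimage_setU -!WE -preimage_setU.
have PmW := Pm; have PnW := Pn; rewrite WE in PmW; rewrite WE in PnW.
have lE l : (0 < P (D @^-1` [set l]))%E -> l = m \/ l = n.
  rewrite WE => /(two_valued_value mW PmnW)[] /eqP; rewrite eqr_nat => /eqP ->;
  by [left|right].
pose cm l := cmean P (D @^-1` [set l]) (Y k).
pose cz r := cmean P (Z @^-1` [set r]) (Y k).
have nondecrD : mts_nondecr P (Y k) D <-> 0 <= cm n - cm m.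
  rewrite subr_ge0; split=> [/(_ m n Pm Pn (ltnW mn))//|cmn l l'].
  move=> /lE[] -> /lE[] ->// nm.
  by move: nm; rewrite leqNgt mn.
have nonincrD : mts_nonincr P (Y k) D <-> cm n - cm m <= 0.
  rewrite subr_le0; split=> [/(_ m n Pm Pn (ltnW mn))//|cmn l l'].
  move=> /lE[] -> /lE[] ->// nm.
  by move: nm; rewrite leqNgt mn.
have nondecrZ : miv_nondecr P ZZ (Y k) Z <-> 0 <= cz y - cz x.
  by rewrite subr_ge0; exact: (two_valued_miv_nondecr mZ xy Px Py Pxy iX (Z_in hS)).
have nonincrZ : miv_nonincr P ZZ (Y k) Z <-> cz y - cz x <= 0.
  by rewrite subr_le0; exact: (two_valued_miv_nonincr mZ xy Px Py Pxy iX (Z_in hS)).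
exists (cm n - cm m), (cz y - cz x); split.
- by rewrite -mul_ge0_same_direction nondecrD nonincrD nondecrZ nonincrZ.
- have geE j : [set w | (j <= D w)%N] = [set w | (j%:R <= W w)].
    by apply/seteqP; split=> w /=; rewrite ler_nat.
  have ltE j : [set w | (D w < j)%N] = [set w | (W w < j%:R)].
    by apply/seteqP; split=> w /=; rewrite ltr_nat.
  (* The larger values [n] and [y] are thresholds separating the atoms; conversely every admissible
     threshold yields the same jumps. *)
  split=> [/(_ n y)|jumps j z].
    rewrite geE ltE.
    have [Pge Plt] := two_valued_split_gt0 mW mnW PmW PnW.
    have [Qge Qlt] := two_valued_split_gt0 mZ xy Px Py.
    move=> /(_ Pge Plt Qge Qlt).
    have [-> ->] := cmean_two_valued_split mW mnW PmnW iX Pge Plt.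
    have [-> ->] := cmean_two_valued_split mZ xy Pxy iX Qge Qlt.
    by rewrite -!WE.
  rewrite geE ltE => Pge Plt Qge Qlt.
  have [-> ->] := cmean_two_valued_split mW mnW PmnW iX Pge Plt.
  have [-> ->] := cmean_two_valued_split mZ xy Pxy iX Qge Qlt.
  by rewrite -!WE.
have [r covr sgr] : exists2 r, covariance P (Y k) W = r%:E & Num.sg r = Num.sg (cm n - cm m).
  have constD : mts_const P (Y k) D -> cm n - cm m = 0.
    by move=> /(_ n m Pn Pm) cnm; rewrite /cm cnm subrr.
  (* A nonnegative jump may be 0; then the nonincreasing lemma bounds the same covariance from
     above. *)
  have [le0|ge0] := leP 0 (cm n - cm m).
    have [r covr [r0 rc]] := setting_mts_nondecr Tk (nondecrD.2 le0).
    exists r => //; apply: sgr_eq_of_direction => // [ge0|/rc/constD//].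
    have [r'] := setting_mts_nonincr Tk (nonincrD.2 ge0).
    by rewrite covr => -[->] [].
  have [r covr [r0 rc]] := setting_mts_nonincr Tk (nonincrD.2 (ltW ge0)).
  exists r => //; apply: sgr_eq_of_direction => // [le0|/rc/constD//].
  by move: ge0; rewrite ltNge le0.
have [s covs sgs] : exists2 s, covariance P (Y k) Z = s%:E & Num.sg s = Num.sg (cz y - cz x).
  have constZ : miv_const P (Y k) Z -> cz y - cz x = 0.
    move=> cZ; apply/eqP; rewrite eq_le; apply/andP; split.
      exact/nonincrZ/miv_const_nonincr.
    exact/nondecrZ/miv_const_nondecr.
  have [le0|ge0] := leP 0 (cz y - cz x).
    have [r' covr' [r0 rc]] := setting_miv_nondecr Tk (nondecrZ.2 le0).
    exists r' => //; apply: sgr_eq_of_direction => // [ge0|/rc/constZ//].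
    have [r''] := setting_miv_nonincr Tk (nonincrZ.2 ge0).
    by rewrite covr' => -[->] [].
  have [r' covr' [r0 rc]] := setting_miv_nonincr Tk (nonincrZ.2 (ltW ge0)).
  exists r' => //; apply: sgr_eq_of_direction => // [le0|/rc/constZ//].
  by move: ge0; rewrite ltNge le0.
rewrite /cov_product -/W covr covs -EFinM lee_fin.
by rewrite -(sgr_ge0 (r * s)) -(sgr_ge0 (_ * (cz y - cz x))) !sgrM sgr sgs.
Qed.

Lemma binary_same_iff_binarized :
  MTS_MIV_same (treatments T) ZZ D Z Y <-> binarized_MTS_MIV (treatments T) D Z Y.
Proof.
split=> h k Tk; have [a [b [same bin _]]] := binary_jumps Tk.
  exact/bin/same/h.
exact/same/bin/(h k Tk).
Qed.

Lemma binary_binarized_iff_SDC :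
  binarized_MTS_MIV (treatments T) D Z Y <-> SDC (treatments T) D Z Y.
Proof.
split=> h k Tk; have [a [b [_ bin sdc]]] := binary_jumps Tk.
  exact/sdc/bin/(h k Tk).
exact/bin/sdc/(h k Tk).
Qed.

End treatment_setting.

(** * The example of part (c) *)

Section borel_identity.
Variable R : realType.

Lemma measurable_id_borel : @measurable_fun _ _ (measurableTypeR R) R setT id.
Proof. exact: measurable_id. Qed.

(* [lebesgue_measure] lives on [measurableTypeR R], whose display differs from
   that of the canonical measurable type [R]. *)
Definition borel_id : {mfun measurableTypeR R >-> R} :=
  @mfun_Sub _ _ (measurableTypeR R) R id (mem_set measurable_id_borel).

End borel_identity.

Section uniform_example.
Import numFieldNormedType.Exports.
Context {d : measure_display} {Omega : measurableType d} {R : realType}.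
Variables (P : probability Omega R) (V : {RV P >-> R}).
Hypothesis hV : uniform05 V.

Let h05 : (0 : R) < 5.
Proof. by []. Qed.

(** Push forward along [V], replace its law by the uniform one, and apply the fundamental theorem of
    calculus; 1/5 is the density. *)
Lemma uniform05_Rintegral (f F : R -> R) (a b : R) : 0 <= a -> a < b -> b <= 5 ->
  measurable_fun [set: R] f -> continuous f -> (forall x : R, is_derive x 1 F (f x)) ->
  (forall x, a < x -> 0 <= f x) ->
  \int[P]_(w in V @^-1` `]a, b]) f (V w) = (F b - F a) / 5.
Proof.
move=> a0 ab b5 mf cf dF f0.
have mfe : measurable_fun [set: R] (EFin \o f) by exact/measurable_EFinP.
have f0' y : `]a, b]%classic y -> (0 <= (f y)%:E)%E.
  by rewrite /= in_itv/= => /andP[ay _]; rewrite lee_fin f0.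
have cF : continuous F.
  move=> x; apply: differentiable_continuous; apply/derivable1_diffP.
  by have [] := dF x.
have mVf : (\int[P]_(w in V @^-1` `]a, b]) (f (V w))%:E =
    \int[distribution P V]_(y in `]a, b]) (f y)%:E)%E.
  rewrite [RHS]ge0_integral_pushforward//; first exact: measurable_funTS.
  by move=> y /set_mem/f0'.
rewrite /Rintegral mVf.
(* The uniform law is carried to the canonical measurable type [R] as the law of [borel_id]. *)
have -> : (\int[distribution P V]_(y in `]a, b]) (f y)%:E =
    \int[distribution (uniform_prob h05) (borel_id R)]_(y in `]a, b]) (f y)%:E)%E.
  by apply: eq_measure_integral => A mA _; exact: (hV h05 mA).
rewrite ge0_integral_pushforward//; last 2 first.
- exact: measurable_funTS.
- by move=> y yI; exact: (f0' _ (set_mem yI)).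
rewrite -[_ @^-1` _]/(`]a, b]%classic).
rewrite integral_mkcond integral_uniform; last 2 first.
  - apply/(@measurable_restrictT _ _ (measurableTypeR R) _ `]a, b]%classic).
      exact: (measurable_itv `]a, b]).
    exact: (@measurable_funTS _ _ (measurableTypeR R) _ _ _ mfe).
  - by move=> y; rewrite patchE; case: ifPn => // /set_mem/f0'.
rewrite -integral_mkcondr setIidr; last first.
  move=> y /=; rewrite !in_itv/= => /andP[ay yb].
  by rewrite (ltW (le_lt_trans a0 ay)) (le_trans yb b5).
(* Adding the null endpoint [a] gives the closed interval on which [continuous_FTC2] is stated. *)
rewrite integral_itv_obnd_cbnd; last first.
  exact: (@measurable_funTS _ _ (measurableTypeR R) _ _ _ mfe).
rewrite (@continuous_FTC2 _ f F)//.
- by rewrite -EFinB -EFinM /= subr0 mulrC.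
- exact: continuous_subspaceT.
- split.
  + by move=> x _; have [] := dF x.
  + exact/cvg_at_right_filter/cF.
  + exact/cvg_at_left_filter/cF.
- by move=> x _; rewrite derive1E; have [] := dF x.
Qed.

Lemma uniform05_Rintegral_id (a b : R) : 0 <= a -> a < b -> b <= 5 ->
  \int[P]_(w in V @^-1` `]a, b]) V w = (b ^+ 2 - a ^+ 2) / 10.
Proof.
move=> a0 ab b5.
have dF (x : R) : is_derive x 1 (2^-1 \*: (@id R ^+ 2)) x.
  by apply: is_derive_eq; rewrite /GRing.scale/=; lra.
rewrite (uniform05_Rintegral a0 ab b5 _ _ dF)//.
- transitivity ((2^-1 * b ^+ 2 - 2^-1 * a ^+ 2) / 5); first by [].
  by field.
- by move=> x; exact: cvg_id.
- by move=> x ax; exact: ltW (le_lt_trans a0 ax).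
Qed.

Lemma uniform05_prob_itv (a b : R) : 0 <= a -> a < b -> b <= 5 ->
  fine (P (V @^-1` `]a, b])) = (b - a) / 5.
Proof.
move=> a0 ab b5; have mV : measurable (V @^-1` `]a, b]).
  by apply: measurable_preimage => //; exact: measurable_funPT.
rewrite -[LHS]mul1r -Rintegral_cst//.
have dF (x : R) : is_derive x 1 id (1 : R) by exact: is_derive_id.
rewrite (uniform05_Rintegral a0 ab b5 _ _ dF)//.
by move=> x; exact: cvg_cst.
Qed.
End uniform_example.

(** * Conditional means in the example *)

Section counterexample_realization.
Context {d : measure_display} {Omega : measurableType d} {R : realType}.
Variables (P : probability Omega R) (V : {RV P >-> R}) (D : {RV P >-> nat})
  (Z : {RV P >-> R}) (Y : nat -> {RV P >-> R}).
Hypothesis hC : counterexample V D Z Y.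

Let hV : uniform05 V := ex_V_law hC.

Let mV B : measurable B -> measurable (V @^-1` B).
Proof. by apply: measurable_preimage; exact: measurable_funPT. Qed.

(* Outside the null points 0 and 1, [D = 0] means [0 < V <= 1] and there [U = V]. *)
Let E := V @^-1` (`]0, 5] `\ 1).

Let mE : measurable E.
Proof. by apply: mV; exact: measurableD. Qed.

Let PE : P (~` E) = 0%E.
Proof.
have h05 : (0 : R) < 5 by [].
apply: measure_negligible; first exact: measurableC.
have -> : ~` E = V @^-1` (~` `]0, 5]) `|` V @^-1` [set 1].
  by rewrite -preimage_setU preimage_setC setCD.
apply: negligibleU; apply/negligibleP.
- by apply: mV; exact: measurableC.
- rewrite -preimage_setC /= probability_setC; last exact: mV.
  have := uniform05_prob_itv hV (lexx 0) h05 (lexx 5).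
  rewrite subr0 divff// => P1.
  rewrite -(fineK (fin_num_measure P _ (mV (measurable_itv `]0, 5])))) P1.
  by rewrite -EFinB subrr.
- exact: mV.
- by rewrite [LHS](hV h05 (measurable_set1 1)) /uniform_prob integral_set1.
Qed.

(** The bound is asked on [E] only, since [V] is unconstrained on the null complement. *)
Lemma counterexample_integrable (F : Omega -> R) (M : R) :
  measurable_fun [set: Omega] F -> (forall w, E w -> `|F w| <= M) ->
  P.-integrable [set: Omega] (EFin \o F).
Proof.
move=> mF FM; have mFe : measurable_fun [set: Omega] (EFin \o F) by exact/measurable_EFinP.
apply/(negligible_integrable (measurableC mE) measurableT mFe PE).
rewrite setTD setCK; apply: (@le_integrable _ _ _ P _ mE _ (EFin \o cst M)).
- exact: measurable_funTS.
- by move=> w Ew /=; rewrite lee_fin (le_trans (FM w Ew))// ler_norm.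
- exact/finite_measure_integrable_cst.
Qed.

Let VE w : E w -> [/\ 0 < V w, V w <= 5 & V w != 1].
Proof. by move=> [/=]; rewrite in_itv/= => /andP[-> ->] /eqP ->. Qed.

Let iV : P.-integrable [set: Omega] (EFin \o V).
Proof.
apply: (@counterexample_integrable _ 5) => [|w /VE[V0 V5 _]]; first exact: measurable_funPT.
by rewrite ger0_norm// ltW.
Qed.

Let iY k : ex_treatments k -> P.-integrable [set: Omega] (EFin \o Y k).
Proof.
(* On [E] one has [V <= 5], hence [U <= 4 * V <= 20]. *)
move=> Tk; apply: (@counterexample_integrable _ (2 * k%:R + 20)) => [|w /VE[V0 V5 _]].
  exact: measurable_funPT.
have k0 : (0 : R) <= k%:R by [].
rewrite (ex_Y_def hC)// ger0_norm /ex_U; case: ifP => _; lra.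
Qed.

Let D_cases w : [\/ D w = 0%N, D w = 1%N | D w = 2%N].
Proof.
rewrite (ex_D_def hC) /ex_D; case: ifP => _; first by constructor 1.
by case: ifP => _; [constructor 2|constructor 3].
Qed.

Lemma counterexample_setting : setting ex_treatments (ex_instruments R) D Z Y.
Proof.
have Z4 w : `|Z w| <= 4.
  by rewrite (ex_Z_def hC) ger0_norm//; case: (D_cases w) => ->; lra.
have mZ : measurable_fun [set: Omega] Z by exact: measurable_funPT.
split.
- by move=> w; rewrite /ex_treatments /=; case: (D_cases w) => ->; [left; left|left; right|right].
- move=> w; rewrite /ex_instruments /= (ex_Z_def hC).
  by case: (D_cases w) => ->; [left; left|left; right|right]; lra.
- exact: iY.
- exact: (counterexample_integrable mZ (fun w _ => Z4 w)).
- move=> k Tk; apply: (le_integrable _ _ _ (integrable_mull 4 (iY Tk))) => //.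
    by apply/measurable_EFinP; apply: measurable_funM => //; exact: measurable_funPT.
  move=> w _ /=; rewrite lee_fin !normrM mulrC ler_wpM2r//.
  by rewrite (le_trans (Z4 w))// ler_norm.
Qed.

Let mD l : measurable (D @^-1` [set l]).
Proof. by rewrite -[_ @^-1` _]setTI; apply: measurable_funPT. Qed.

Let prob_piece (A : set Omega) (a b : R) : measurable A ->
  0 <= a -> a < b -> b <= 5 -> A `&` E = V @^-1` `]a, b] `&` E ->
  fine (P A) = (b - a) / 5.
Proof.
move=> mA a0 ab b5 AE; rewrite -(uniform05_prob_itv hV a0 ab b5).
by rewrite (prob_setI_full mA mE PE) AE -prob_setI_full//; exact: mV.
Qed.

(** The point 1 is excluded because [U] jumps to 4 there, while [U = V] on the rest of []0, 1]]. *)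
Let Rintegral_piece k (A : set Omega) (a b c : R) : ex_treatments k -> measurable A ->
  0 <= a -> a < b -> b <= 5 -> A `&` E = V @^-1` `]a, b] `&` E ->
  (forall v, v \in `]a, b] -> v != 1 -> ex_U v = c * v) ->
  \int[P]_(w in A) Y k w = 2 * k%:R * ((b - a) / 5) + c * ((b ^+ 2 - a ^+ 2) / 10).
Proof.
move=> Tk mA a0 ab b5 AE Uc.
have mI := mV (measurable_itv `]a, b]).
rewrite (Rintegral_setI_full mA mE PE (iY Tk)) AE.
have iL : P.-integrable [set: Omega] (EFin \o (fun w => 2 * k%:R + c * V w)).
  by apply: integrable_add; [exact: integrable_cst|exact: integrable_mull].
transitivity (\int[P]_(w in V @^-1` `]a, b] `&` E) (2 * k%:R + c * V w)).
  apply: eq_Rintegral => w /set_mem[Vw /VE[_ _ V1]].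
  by rewrite (ex_Y_def hC)// Uc.
rewrite -(Rintegral_setI_full mI mE PE iL) RintegralD//; last 2 first.
- by apply: integrable_restr => //; exact: integrable_cst.
- by apply: integrable_restr => //; exact: integrable_mull.
rewrite Rintegral_cst// RintegralZl//; last exact: integrable_restr.
by rewrite (uniform05_Rintegral_id hV)// (uniform05_prob_itv hV).
Qed.

(** Probabilities of the levels: the lengths 1, 1/2 and 7/2 divided by 5. *)
Let mass (l : nat) : R := nth 0 [:: 5^-1; 10^-1; 7 / 10] l.

(** Integrals of [Y k] over the levels of [D]. In the last one, 28/10 is 7/10 from []3/2, 2]], where
    [U = 4 * V], plus 21/10 from []2, 5]], where [U = V]. *)
Let total (k l : nat) : R :=
  nth 0 [:: 2 * k%:R / 5 + 10^-1; 2 * k%:R / 10 + 2^-1; 14 * k%:R / 10 + 28 / 10] l.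

Let D0E : D @^-1` [set 0%N] `&` E = V @^-1` `]0, 1] `&` E.
Proof.
apply/seteqP; split=> w [+ Ew]; have [V0 V5 V1] := VE Ew; rewrite /= (ex_D_def hC) /ex_D !in_itv/=.
  by rewrite V0 (ltW V0)/=; case: ifP => //; case: ifP.
by rewrite V0 (ltW V0)/= => ->.
Qed.

Let D1E : D @^-1` [set 1%N] `&` E = V @^-1` `]1, (3 / 2)] `&` E.
Proof.
apply/seteqP; split=> w [+ Ew]; have [V0 V5 V1] := VE Ew; rewrite /= (ex_D_def hC) /ex_D !in_itv/=.
  by case: ifP => //; case: ifP.
by move=> /andP[V1' V2]; rewrite [V w <= 1]leNgt V1' andbF V2.
Qed.

Let D2E : D @^-1` [set 2%N] `&` E = V @^-1` `](3 / 2), 5] `&` E.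
Proof.
apply/seteqP; split=> w [+ Ew]; have [V0 V5 V1] := VE Ew; rewrite /= (ex_D_def hC) /ex_D !in_itv/=.
  rewrite (ltW V0) V5 /= andbT; case: ifP => // V1'; case: ifP => // + _.
  by rewrite ltNge V1' /= ltNge => ->.
move=> /andP[V32 _]; rewrite (ltW V0) /=.
have -> : (V w <= 1) = false by apply/negbTE; rewrite -ltNge; lra.
by rewrite [V w <= _]leNgt V32 andbF.
Qed.

Lemma counterexample_mass l : (l < 3)%N -> fine (P (D @^-1` [set l])) = mass l.
Proof.
case: l => [|[|[|//]]] _; rewrite /mass /=.
- by rewrite (prob_piece (mD 0) _ _ _ D0E)//; lra.
- by rewrite (prob_piece (mD 1) _ _ _ D1E)//; lra.
- by rewrite (prob_piece (mD 2) _ _ _ D2E)//; lra.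
Qed.

Lemma counterexample_total k l : ex_treatments k -> (l < 3)%N ->
  \int[P]_(w in D @^-1` [set l]) Y k w = total k l.
Proof.
move=> Tk; case: l => [|[|[|//]]] _; rewrite /total /=.
- rewrite (Rintegral_piece (c := 1) Tk (mD 0) _ _ _ D0E)//; [lra..|].
  move=> v; rewrite /ex_U !in_itv/= => /andP[_ v1] nv1.
  by rewrite [1 <= v]leNgt lt_neqAle nv1 v1/= mul1r.
- rewrite (Rintegral_piece (c := 4) Tk (mD 1) _ _ _ D1E)//; [lra..|].
  by move=> v; rewrite /ex_U !in_itv/= => /andP[v1 v2] _; rewrite (_ : _ && _)//; lra.
- have m2 : measurable (V @^-1` `]-oo, 2]) by exact: mV.
  rewrite (Rintegral_setID (mD 2) m2 (iY Tk)).
  rewrite (Rintegral_piece (a := 3 / 2) (b := 2) (c := 4) Tk); last first.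
  + move=> v; rewrite /ex_U !in_itv/= => /andP[v1 v2] _; rewrite (_ : _ && _)//.
    by apply/andP; split; lra.
  + rewrite [LHS]setIAC D2E; apply/seteqP; split=> w /=; rewrite !in_itv/=.
      by move=> [[/andP[V1 _] Ew] V2]; rewrite V1 V2.
    by move=> [/andP[V1 V2] Ew]; rewrite V1 V2 (le_trans V2)//; lra.
  + lra.
  + lra.
  + lra.
  + exact: measurableI.
  rewrite (Rintegral_piece (a := 2) (b := 5) (c := 1) Tk); first lra.
  + exact: measurableD.
  + lra.
  + lra.
  + lra.
  + rewrite setDE [LHS]setIAC D2E; apply/seteqP; split=> w /=; rewrite !in_itv/=.
      by move=> [[/andP[V1 V5] Ew] /negP]; rewrite -ltNge V5 => ->.
    move=> [/andP[V2 V5] Ew]; rewrite V5 (lt_trans _ V2)/=; last lra.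
    by split=> //; apply/negP; rewrite -ltNge.
  + move=> v; rewrite /ex_U !in_itv/= => /andP[v2 _] _.
    by rewrite [v <= 2]leNgt v2 andbF mul1r.
Qed.

(** A general predicate covers both sides of a split, [j <= D] and [D < j]. *)
Lemma counterexample_cmean k (Q : pred nat) : ex_treatments k ->
  cmean P [set w | Q (D w)] (Y k) =
  (\sum_(l <- iota 0 3) if Q l then total k l else 0) /
  (\sum_(l <- iota 0 3) if Q l then mass l else 0).
Proof.
move=> Tk; have D2 w : (D w <= 2)%N by case: (D_cases w) => ->.
have mQ : measurable [set w | Q (D w)].
  exact: (measurable_treatment mD [set n | Q n]).
have splitQ F : P.-integrable [set: Omega] (EFin \o F) ->
    \int[P]_(w in [set w | Q (D w)]) F w =
    \sum_(l <- iota 0 3) if Q l then \int[P]_(w in D @^-1` [set l]) F w else 0.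
  move=> iF; rewrite (Rintegral_treatment_sum mD D2 mQ iF).
  apply: eq_bigr => l _; case: ifPn => [Ql|/negP Ql].
    congr (Rintegral _ _ _); apply/seteqP; split=> w /= => [[]//|Dl].
    by rewrite Dl.
  rewrite (_ : _ `&` _ = set0) ?Rintegral_set0//.
  by apply/seteqP; split=> w //= [+ Dl]; rewrite Dl.
have eq3 (f g : nat -> R) : (forall l, (l < 3)%N -> f l = g l) ->
    \sum_(l <- iota 0 3) (if Q l then f l else 0) =
    \sum_(l <- iota 0 3) (if Q l then g l else 0).
  move=> fg; rewrite big_seq [RHS]big_seq; apply: eq_bigr => l.
  by rewrite mem_iota add0n /= => l3; rewrite fg.
rewrite /cmean splitQ; last exact: iY.
rewrite (eq3 (fun l => \int[P]_(w in D @^-1` [set l]) Y k w) (total k)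
  (fun l => counterexample_total Tk)).
congr (_ / _).
rewrite -[LHS]mul1r -Rintegral_cst// splitQ; last exact: integrable_cst.
by apply: eq3 => l l3; rewrite Rintegral_cst// mul1r counterexample_mass.
Qed.

Lemma counterexample_jump k (j : nat) : ex_treatments k ->
  (0 < P [set w | (j <= D w)%N])%E -> (0 < P [set w | (D w < j)%N])%E ->
  0 <= cmean P [set w | (j <= D w)%N] (Y k) - cmean P [set w | (D w < j)%N] (Y k).
Proof.
move=> Tk Pge Plt.
have k0 : (0 : R) <= k%:R by [].
have := counterexample_cmean (leq j) Tk.
have := counterexample_cmean (fun l => (l < j)%N) Tk.
(* Only [j = 1] and [j = 2] leave both sides nonempty. The shift [2 * k] cancels, and the jumps are
   33/8 - 1/2 = 29/8 and 4 - 2 = 2. *)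
rewrite /= => -> ->; case: j Pge Plt => [_|[|[|j]]].
- rewrite (_ : mkset _ = set0) ?measure0 ?ltxx//.
  by apply/seteqP; split=> w /=; rewrite ?ltn0.
- move=> _ _; rewrite /= !big_cons !big_nil /= /mass /total /=.
  by rewrite [leRHS](_ : _ = 29 / 8) ?divr_ge0//; field.
- move=> _ _; rewrite /= !big_cons !big_nil /= /mass /total /=.
  by rewrite [leRHS](_ : _ = 2) ?divr_ge0//; field.
- rewrite (_ : mkset _ = set0) ?measure0 ?ltxx//.
  by apply/seteqP; split=> w //=; case: (D_cases w) => ->.
Qed.

Lemma counterexample_binarized : binarized_MTS_MIV ex_treatments D Z Y.
Proof.
move=> k Tk j z /= Pge Plt.
(* As [Z = 2 * D], a threshold on [Z] is a threshold on [D], so both factors are jumps of the same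
   kind, nonnegative by [counterexample_jump]. *)
have [j' [geE ltE]] : exists j', [set w | z <= Z w] = [set w | (j' <= D w)%N] /\
    [set w | Z w < z] = [set w | (D w < j')%N].
  suff [j' geE] : exists j', forall w, (z <= Z w) = (j' <= D w)%N.
    exists j'; split; apply/seteqP; split=> w /=; rewrite ?geE//;
      by rewrite ltNge ltnNge geE.
  have ZE := ex_Z_def hC.
  have [z0|z0] := leP z 0.
    by exists 0%N => w; rewrite ZE (le_trans z0).
  have [z2|z2] := leP z 2.
    exists 1%N => w; rewrite ZE; case: (D_cases w) => ->.
    - by apply: negbTE; rewrite -ltNge; lra.
    - by rewrite mulr1.
    - by rewrite (le_trans z2)//; lra.
  have [z4|z4] := leP z 4.
    exists 2%N => w; rewrite ZE; case: (D_cases w) => ->.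
    - by apply: negbTE; rewrite -ltNge; lra.
    - by apply: negbTE; rewrite -ltNge; lra.
    - by rewrite (le_trans z4)//; lra.
  by exists 3%N => w; rewrite ZE; case: (D_cases w) => ->; apply: negbTE; rewrite -ltNge; lra.
rewrite geE ltE => Qge Qlt.
by rewrite mulr_ge0//; exact: counterexample_jump.
Qed.

Lemma counterexample_not_MTS : ~ MTS ex_treatments D Y.
Proof.
have Pgt0 l : (l < 3)%N -> (0 < P (D @^-1` [set l]))%E.
  move=> l3; rewrite -(fineK (fin_num_measure P _ (mD l))) lte_fin.
  by rewrite counterexample_mass//; case: l l3 => [|[|[|]]] //= _; rewrite /mass /=; lra.
have T0 : ex_treatments 0 by left; left.
have cm l : (l < 3)%N -> cmean P (D @^-1` [set l]) (Y 0%N) = total 0 l / mass l.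
  by move=> l3; rewrite /cmean counterexample_total// counterexample_mass.
(* For [Y 0 = U] the means 1/2, 5, 4 rise and then fall: levels 1 and 2 refute one direction, levels
   0 and 1 the other. *)
move=> /(_ 0%N T0)[mono|mono].
  have := mono 1%N 2%N (Pgt0 1%N isT) (Pgt0 2%N isT) isT.
  by rewrite !cm// /total /mass /=; lra.
have := mono 0%N 1%N (Pgt0 0%N isT) (Pgt0 1%N isT) isT.
by rewrite !cm// /total /mass /=; lra.
Qed.

End counterexample_realization.

(** * Realization of the example on the real line, with [V] the identity *)

Section counterexample_existence.
Variable R : realType.

Let h05 : (0 : R) < 5.
Proof. by []. Qed.

Let P : probability (measurableTypeR R) R := uniform_prob h05.

Let V : {RV P >-> R} := borel_id R.

Let measurable_mem_itv (i : interval R) : measurable_fun [set: R] (fun v => v \in i).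
Proof.
apply: (measurable_fun_bool true); rewrite setTI (_ : _ @^-1` _ = [set` i])//.
Qed.

Lemma measurable_ex_D : measurable_fun [set: R] (@ex_D R).
Proof. by apply: measurable_fun_ifT => //; apply: measurable_fun_ifT. Qed.

Lemma measurable_ex_U : measurable_fun [set: R] (@ex_U R).
Proof. by apply: measurable_fun_ifT => //; apply: measurable_funM. Qed.

Lemma counterexample_exists : exists (d : measure_display)
  (Omega : measurableType d) (P : probability Omega R) (V : {RV P >-> R})
  (D : {RV P >-> nat}) (Z : {RV P >-> R}) (Y : nat -> {RV P >-> R}),
  counterexample V D Z Y.
Proof.
have mD : @measurable_fun _ _ (measurableTypeR R) nat setT (@ex_D R) := measurable_ex_D.
have mZ : @measurable_fun _ _ (measurableTypeR R) R setT (fun v => 2 * (ex_D v)%:R).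
  apply: measurable_funM => //.
  apply: (measurable_treatment_natr (D := @ex_D R)) => l.
  by rewrite -[_ @^-1` _]setTI; exact: mD.
have mY k : @measurable_fun _ _ (measurableTypeR R) R setT (fun v => 2 * k%:R + ex_U v).
  apply: measurable_funD => //; exact: measurable_ex_U.
exists _, (measurableTypeR R), P, V,
  (@mfun_Sub _ _ (measurableTypeR R) nat _ (mem_set mD)),
  (@mfun_Sub _ _ (measurableTypeR R) R _ (mem_set mZ)),
  (fun k => @mfun_Sub _ _ (measurableTypeR R) R _ (mem_set (mY k))).
by split.
Qed.

End counterexample_existence.

(** * The example of part (e) *)

Section opposite_directions_example.
Variable R : realType.

Let P : probability bool R := bernoulli_prob (2^-1).

Let level (b : bool) : nat := b.+1.

Let mlevel : measurable_fun [set: bool] level.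
Proof. by []. Qed.

Let mfun_real (f : bool -> R) : measurable_fun [set: bool] f.
Proof. by []. Qed.

(** Toss a fair coin to draw [D] from 1 and 2, and put [Z = - D] and [Y k = D]. The conditional
    means [l] and [- z] are strictly monotone in opposite directions, so
    [opposite_directions_not_SDC] applies. *)
Lemma MTS_MIV_not_SDC : exists (d : measure_display) (Omega : measurableType d)
  (P : probability Omega R) (T : nat) (ZZ : set R) (D : {RV P >-> nat})
  (Z : {RV P >-> R}) (Y : nat -> {RV P >-> R}),
  [/\ setting (treatments T) ZZ D Z Y, MTS_MIV (treatments T) ZZ D Z Y
    & ~ SDC (treatments T) D Z Y].
Proof.
pose D : {RV P >-> nat} := @mfun_Sub _ _ bool nat _ (mem_set mlevel).
pose Z : {RV P >-> R} :=
  @mfun_Sub _ _ bool R _ (mem_set (mfun_real (fun b => - (level b)%:R))).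
pose Y (k : nat) : {RV P >-> R} :=
  @mfun_Sub _ _ bool R _ (mem_set (mfun_real (fun b => (level b)%:R))).
have bounded_int (f : bool -> R) : P.-integrable [set: bool] (EFin \o f).
  apply: (le_integrable _ _ _ (integrable_cst P (`|f true| + `|f false|))) => //.
  by move=> [] _ /=; rewrite lee_fin [leRHS]ger0_norm ?addr_ge0// ?lerDl ?lerDr.
have Pgt0 b : (0 < P [set b])%E.
  rewrite /P /= /bernoulli_prob ifT; last by apply/andP; split; lra.
  by rewrite fsbig_set1 lte_fin /bernoulli_pmf; case: b; lra.
have hS : setting (treatments 2) [set: R] D Z Y.
  by split=> [[]||k _||k _] //; exact: bounded_int.
have T1 : treatments 2 1 by [].
have level12 l : (0 < P (D @^-1` [set l]))%E -> exists b, level b = l.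
  move=> Pl; apply: contrapT => nb; move: Pl.
  rewrite (_ : _ @^-1` _ = set0) ?measure0 ?ltxx//.
  by apply/seteqP; split=> // b /= bl; apply: nb; exists b.
have preD b : D @^-1` [set level b] = [set b].
  by apply/seteqP; split=> -[]; case: b.
have preZ b : Z @^-1` [set - (level b)%:R] = [set b].
  apply/seteqP; split=> [b' /= /oppr_inj/eqP|b' -> //].
  by rewrite eqr_nat => /eqP; case: b b' => -[].
have cm k b : cmean P [set b] (Y k) = (level b)%:R.
  rewrite /cmean (_ : Rintegral _ _ _ = \int[P]_(w in [set b]) (level b)%:R).
    rewrite Rintegral_cst// mulfK// fine_eq0 ?fin_num_measure//.
    by rewrite gt_eqF//; exact: Pgt0.
  by apply: eq_Rintegral => w /set_mem ->.
have opp : MTS_MIV_opposite (treatments 2) [set: R] D Z Y.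
  move=> k _; left; split.
    move=> l l' /level12[b <-] /level12[b' <-] bb'.
    by rewrite !preD !cm ler_nat.
  (* Since [Y k = - Z], the map [- z] is a version. *)
  exists (fun z => - z); last by move=> z z' _ _; rewrite lerN2.
  split=> [||B mB].
  - exact: measurableT_comp.
  - exact: bounded_int.
  - by apply: eq_Rintegral => w _; rewrite /= opprK.
exists _, bool, P, 2%N, [set: R], D, Z, Y; split=> //.
  by split=> k Tk; case: (opp k Tk) => -[mts miv]; [left|right|right|left].
apply/(opposite_directions_not_SDC hS opp); exists 1%N; split=> //.
- move=> /(_ (level false) (level true)); rewrite !preD !cm => /(_ (Pgt0 _) (Pgt0 _)).
  by move/eqP; rewrite eqr_nat.
- move=> [c vc].
  have mZ : measurable_fun [set: bool] Z by exact: measurable_funPT.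
  have cE b : c = (level b)%:R.
    (* A constant version would equal the mean at both atoms, where the values are 1 and 2. *)
    rewrite -(cm 1%N b) -preZ; apply: (is_cmean_version_atom mZ vc).
    by rewrite preZ.
  by have := cE true; rewrite (cE false) => /eqP; rewrite eqr_nat.
Qed.

End opposite_directions_example.

Theorem mainTheorem3 (R : realType) :
  (* (a) *)
  (forall (d : measure_display) (Omega : measurableType d)
      (P : probability Omega R) (T : nat) (ZZ : set R) (D : {RV P >-> nat})
      (Z : {RV P >-> R}) (Y : nat -> {RV P >-> R}),
    setting (treatments T) ZZ D Z Y ->
    MTS_MIV_same (treatments T) ZZ D Z Y -> SDC (treatments T) D Z Y) /\
  (* (b) *)
  (forall (d : measure_display) (Omega : measurableType d)
      (P : probability Omega R) (T : nat) (ZZ : set R) (D : {RV P >-> nat})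
      (Z : {RV P >-> R}) (Y : nat -> {RV P >-> R}),
    setting (treatments T) ZZ D Z Y -> binary P D -> binary P Z ->
    (MTS_MIV_same (treatments T) ZZ D Z Y <->
       binarized_MTS_MIV (treatments T) D Z Y) /\
    (binarized_MTS_MIV (treatments T) D Z Y <-> SDC (treatments T) D Z Y)) /\
  (* (c): the example exists, and any realization of it is as claimed *)
  ((exists (d : measure_display) (Omega : measurableType d)
      (P : probability Omega R) (V : {RV P >-> R}) (D : {RV P >-> nat})
      (Z : {RV P >-> R}) (Y : nat -> {RV P >-> R}), counterexample V D Z Y) /\
   (forall (d : measure_display) (Omega : measurableType d)
      (P : probability Omega R) (V : {RV P >-> R}) (D : {RV P >-> nat})
      (Z : {RV P >-> R}) (Y : nat -> {RV P >-> R}),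
    counterexample V D Z Y ->
    [/\ setting ex_treatments (ex_instruments R) D Z Y,
        binarized_MTS_MIV ex_treatments D Z Y
      & ~ MTS_MIV ex_treatments (ex_instruments R) D Z Y])) /\
  (* (d): SDC fails except exactly in the degenerate case where, for every
     level, one of the two conditional means is constant *)
  (forall (d : measure_display) (Omega : measurableType d)
      (P : probability Omega R) (T : nat) (ZZ : set R) (D : {RV P >-> nat})
      (Z : {RV P >-> R}) (Y : nat -> {RV P >-> R}),
    setting (treatments T) ZZ D Z Y ->
    MTS_MIV_opposite (treatments T) ZZ D Z Y ->
    ODC (treatments T) D Z Y /\
    (~ SDC (treatments T) D Z Y <->
       exists k : nat, [/\ treatments T k, ~ mts_const P (Y k) D
                         & ~ miv_const P (Y k) Z])) /\
  (* (e) *)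
  (exists (d : measure_display) (Omega : measurableType d)
      (P : probability Omega R) (T : nat) (ZZ : set R) (D : {RV P >-> nat})
      (Z : {RV P >-> R}) (Y : nat -> {RV P >-> R}),
    [/\ setting (treatments T) ZZ D Z Y,
        MTS_MIV (treatments T) ZZ D Z Y
      & ~ SDC (treatments T) D Z Y]).
Proof.
split; first by move=> d Omega P T ZZ D Z Y; exact: same_direction_SDC.
split.
  move=> d Omega P T ZZ D Z Y hS binD binZ; split.
    exact: (binary_same_iff_binarized hS binD binZ).
  exact: (binary_binarized_iff_SDC hS binD binZ).
split.
  split; first exact: counterexample_exists.
  move=> d Omega P V D Z Y hC; split.
  - exact: (counterexample_setting hC).
  - exact: (counterexample_binarized hC).
  - by move=> [/(counterexample_not_MTS hC)].
split; last exact: MTS_MIV_not_SDC.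
move=> d Omega P T ZZ D Z Y hS opp; split.
  exact: (opposite_directions_ODC hS opp).
exact: (opposite_directions_not_SDC hS opp).
Qed.
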